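(* Let $b$ be a non-negative integer and let $P(z)=\prod_{i=1}^\infty(1-z^i)^{-1}$. As formal power series, $$\sum_{r=0}^\infty\Bigl(\lim_{m,n\to\infty}p\bigl((n-b,b),(m),(mn-r,r)\bigr)\Bigr)z^r=\frac{z^b(1-z)}{\prod_{i=1}^b(1-z^i)}\,P(z);$$ for $b\ge1$ the right-hand side is $\dfrac{z^b}{(1-z^2)\cdots(1-z^b)}P(z)$.
   Context: For partitions $\nu\vdash n$, $\mu\vdash m$, $\lambda\vdash mn$, the plethysm coefficient $p(\nu,\mu,\lambda)=\langle s_\nu\circ s_\mu,s_\lambda\rangle$ is the multiplicity of the Schur function $s_\lambda$ in the plethysm $s_\nu\circ s_\mu$. For fixed $b$ and $r$ the coefficient $p((n-b,b),(m),(mn-r,r))$ is constant for all sufficiently large $m$ and $n$; the limit denotes this constant value. *)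

(* Defs.v *)
From mathcomp Require Import all_boot all_order all_algebra.
From mathcomp.multinomials Require Import mpoly.
From Stdlib Require Import ClassicalEpsilon.

Set Implicit Arguments.
Unset Strict Implicit.
Unset Printing Implicit Defensive.

Import Order.TTheory GRing.Theory Num.Theory.
Local Open Scope ring_scope.

(* Parts are listed in weakly decreasing order, without zero parts. *)
Definition is_part (la : seq nat) : bool := sorted geq la && (0%N \notin la).

Definition partitions (d : nat) : seq (seq nat) :=
  [seq la <- [seq map val (t : seq 'I_d.+1) | t : {bseq d of 'I_d.+1}]
         | is_part la & sumn la == d].

Lemma mem_partitions d la :
  (la \in partitions d) = is_part la && (sumn la == d).
Proof.
rewrite mem_filter; case: (boolP (is_part la && _)) => //= /andP[laP /eqP lad].
have /andP[_ la0] := laP.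
have le_size : (size la <= d)%N.
  rewrite -lad; elim: la la0 {laP lad} => //= x la IH.
  rewrite in_cons negb_or => /andP[x0 /IH le]; rewrite -add1n.
  by apply: leq_add => //; rewrite lt0n eq_sym.
have le_part x : x \in la -> (x < d.+1)%N.
  rewrite ltnS -lad; elim: la {laP lad la0 le_size} => //= y la IH.
  rewrite in_cons => /predU1P[->|/IH le]; first exact: leq_addr.
  by rewrite (leq_trans le) // leq_addl.
have szP : (size (map (fun x => inord x : 'I_d.+1) la) <= d)%N.
  by rewrite size_map.
apply/mapP; exists (Bseq szP); first by rewrite mem_enum.
rewrite /= -map_comp -[LHS]map_id; apply/eq_in_map => x /le_part lt_x /=.
by rewrite inordK.
Qed.

Lemma partitions_uniq d : uniq (partitions d).
Proof.
rewrite filter_uniq // map_inj_uniq ?enum_uniq // => s t /(inj_map val_inj).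
exact: val_inj.
Qed.

(* The partition (a,b), for a >= b; this is (a) when b = 0. *)
Definition two_row (a b : nat) : seq nat := [seq x <- [:: a; b] | (0 < x)%N].

(* A symmetric function F is represented by its restrictions
   F(x_0, ..., x_{N-1}) to N variables, for all N. *)
Definition symfun := forall N : nat, {mpoly int[N]}.

(* The boxes (i, j) of the Young diagram of la: 0 <= j < la_i. *)
Definition cell (la : seq nat) : finType :=
  {i : 'I_(size la) & 'I_(nth 0%N la i)}.

Definition cell_row la (c : cell la) : nat := tag c.
Definition cell_col la (c : cell la) : nat := tagged c.

Definition is_ssyt la N (t : {ffun cell la -> 'I_N}) : bool :=
  [forall c : cell la, forall d : cell la,
     ((cell_row c == cell_row d) && (cell_col c < cell_col d)%N
        ==> (t c <= t d)%N)
  && ((cell_col c == cell_col d) && (cell_row c < cell_row d)%N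
        ==> (t c < t d)%N)].

Definition schur (la : seq nat) : symfun := fun N =>
  \sum_(t : {ffun cell la -> 'I_N} | is_ssyt t) \prod_(c : cell la) 'X_(t c).

(* The monomials of p, each repeated according to its coefficient; this is
   only meaningful if all coefficients are non-negative. *)
Definition monomials N (p : {mpoly int[N]}) : seq 'X_{1..N} :=
  flatten [seq nseq `|p@_m|%N m | m <- msupp p].

(* F o G is obtained by substituting the monomials of G for the variables of
   F, for G with non-negative coefficients. *)
Definition plethysm (F G : symfun) : symfun := fun N =>
  F (size (monomials (G N)))
    \mPo [tuple of [seq 'X_[m] | m <- in_tuple (monomials (G N))]].

(* c lists the coefficients of F, homogeneous of degree d, in the basis of
   Schur functions. *)
Definition schur_expansion (F : symfun) (d : nat) (c : seq nat -> int) : Prop :=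
  forall N, F N = \sum_(la <- partitions d) c la *: schur la N.

(* The expansion exists because Schur functions form a Z-basis, and its
   values on partitions of d are then unique. *)
Definition schur_coef (F : symfun) (d : nat) (la : seq nat) : int :=
  epsilon (inhabits (fun=> 0)) (schur_expansion F d) la.

Definition plethysm_coef (nu mu la : seq nat) : int :=
  schur_coef (plethysm (schur nu) (schur mu)) (sumn nu * sumn mu) la.

(* u is constant, equal to l, for all sufficiently large m and n. *)
Definition stable_limit (u : nat -> nat -> int) (l : int) : Prop :=
  exists M : nat, forall m n : nat, (M <= m)%N -> (M <= n)%N -> u m n = l.

(* f stands for the series with coefficient f r at z^r. *)
Definition fps := nat -> int.

Definition fps_poly (p : {poly int}) : fps := fun r => p`_r.

Definition fps_mul (f g : fps) : fps :=
  fun r => \sum_(i < r.+1) f i * g (r - i)%N.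

(* The first n coefficients of 1/f, determined by f * (1/f) = 1. *)
Fixpoint fps_inv_seq (f : fps) (n : nat) : seq int :=
  if n is k.+1 then
    let s := fps_inv_seq f k in
    rcons s ((f 0%N)^-1 * ((k == 0%N)%:R - \sum_(i < k) s`_i * f (k - i)%N))
  else [::].

Definition fps_inv (f : fps) : fps := fun r => (fps_inv_seq f r.+1)`_r.

Definition fps_div (f g : fps) : fps := fps_mul f (fps_inv g).

Lemma size_fps_inv_seq f n : size (fps_inv_seq f n) = n.
Proof. by elim: n => //= n IH; rewrite size_rcons IH. Qed.

Lemma nth_fps_inv_seq f n i :
  (i < n)%N -> (fps_inv_seq f n)`_i = fps_inv f i.
Proof.
elim: n => // n IH; rewrite ltnS leq_eqVlt => /predU1P[-> // | lt_in].
by rewrite -IH //= nth_rcons size_fps_inv_seq lt_in.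
Qed.

Lemma fps_invE f r :
  fps_inv f r = (f 0%N)^-1 *
    ((r == 0%N)%:R - \sum_(i < r) fps_inv f i * f (r - i)%N).
Proof.
rewrite {1}/fps_inv /= nth_rcons size_fps_inv_seq ltnn eqxx.
by congr (_ * (_ - _)); apply: eq_bigr => i _; rewrite nth_fps_inv_seq.
Qed.

Lemma fps_mulVr f : f 0%N \is a GRing.unit ->
  fps_mul (fps_inv f) f =1 fps_poly 1.
Proof.
move=> f0 r; rewrite /fps_mul big_ord_recr /= subnn (fps_invE f r) mulrAC.
by rewrite mulVr // mul1r addrCA subrr addr0 /fps_poly coef1.
Qed.

(* The partial product (1 - z)^-1 (1 - z^2)^-1 ... (1 - z^k)^-1. *)
Definition P_upto (k : nat) : fps :=
  \big[fps_mul/fps_poly 1]_(1 <= i < k.+1) fps_inv (fps_poly (1 - 'X^i)).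

(* The infinite product P(z): the coefficient of z^r is the same in all
   partial products with at least r factors, see P_upto_stable. *)
Definition P_series : fps := fun r => P_upto r r.

Lemma fps_inv_1subXn_low i r : (0 < r < i)%N ->
  fps_inv (fps_poly (1 - 'X^i)) r = 0.
Proof.
move=> /andP[r0 lt_ri]; rewrite fps_invE big1 ?subr0 => [|j _].
  by rewrite (gtn_eqF r0) mulr0.
have jr := ltn_ord j; rewrite /fps_poly coefB coef1 coefXn subn_eq0 leqNgt jr.
by rewrite ltn_eqF ?subrr ?mulr0 // (leq_ltn_trans (leq_subr _ _)).
Qed.

Lemma P_upto_stable k r : (r <= k)%N -> P_upto k r = P_series r.
Proof.
pose F i := fps_inv (fps_poly (1 - 'X^i)).
have F0 i : (0 < i)%N -> F i 0%N = 1.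
  move=> i0; rewrite /F fps_invE big_ord0 /fps_poly coefB coef1 coefXn.
  by rewrite eqxx subr0 eq_sym (gtn_eqF i0) subr0 mulr1 invr1.
have stable s t j : all (ltn r) t -> (j <= r)%N ->
    (\big[fps_mul/fps_poly 1]_(i <- s ++ t) F i) j
    = (\big[fps_mul/fps_poly 1]_(i <- s) F i) j.
  move=> t_gt; elim: s j => [|i s IH] j le_jr /=; last first.
    rewrite !big_cons; apply: eq_bigr => l _; congr (_ * _).
    by rewrite IH // (leq_trans (leq_subr _ _)).
  rewrite big_nil; elim: t t_gt j le_jr => [_|i t IH /= /andP[lt_ri /IH{}IH]] j le_jr.
    by rewrite big_nil.
  rewrite big_cons /fps_mul big_ord_recl F0 ?(leq_ltn_trans _ lt_ri) // mul1r.
  rewrite subn0 IH // big1 ?addr0 // => l _.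
  by rewrite /F fps_inv_1subXn_low ?mul0r //= (leq_ltn_trans _ lt_ri) //
     (leq_trans _ le_jr) // ltn_ord.
move=> le_rk; rewrite /P_series /P_upto.
have -> : index_iota 1 k.+1 = index_iota 1 r.+1 ++ index_iota r.+1 k.+1.
  by rewrite /index_iota !subSS !subn0 -{1}(subnKC le_rk) iotaD add1n.
by apply: stable => //; apply/allP => i; rewrite mem_index_iota => /andP[].
Qed.

(* Main.v *)
Require Import Defs.
From mathcomp Require Import all_boot all_order all_algebra.
From HB Require Import structures.
From mathcomp Require Import all_fingroup zify.
From mathcomp.multinomials Require Import mpoly.
From Stdlib Require Import ClassicalEpsilon FunctionalExtensionality.

(* In two variables the coefficient of s_(d-r,r) in a symmetric function F of
   degree d is [x^(d-r) y^r] F - [x^(d-r+1) y^(r-1)] F.  For F the plethysm of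
   s_(n-b,b) with s_(m) the first of these counts the semistandard tableaux of
   shape (n-b,b) with entries in {0, ..., m} and sum r.  If n is large, the
   first b entries of the first row are 0, so such a tableau is a pair of a
   partition (first row) and a partition with b positive parts (second row):
   the generating function is P(z) z^b / ((1-z)...(1-z^b)), and taking
   differences multiplies it by 1 - z.

   That a Schur expansion of the plethysm exists at all rests on the symmetry
   of Schur polynomials (the Bender-Knuth involution) and the unitriangularity
   of the Kostka matrix. *)

Set Implicit Arguments.
Unset Strict Implicit.
Unset Printing Implicit Defensive.

Import GRing.Theory.
Local Open Scope ring_scope.

(** * Symmetry of Schur polynomials *)

(** [schur_coef] is an [epsilon] choice, so it says something only once an expansion valid for all
    numbers of variables at once has been exhibited; the coefficient is then read off from whichever
    expansion was chosen. The plethysm substitutes a list of monomials in an unspecified order, so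
    even its own symmetry rests on that of the outer Schur polynomial in its list of arguments. This
    is why Schur polynomials are evaluated below at arbitrary elements of a commutative ring.
    Tableaux with entries in {0, ..., m} appear because s_(m)(x, y) is the sum of the monomials
    x^(m-i) y^i: an entry i contributes y^i, and the exponent of y is the sum of the entries. *)

Lemma geq_trans : transitive geq.
Proof. by move=> a b c /= ba ca; apply: leq_trans ca ba. Qed.

Lemma ord2_cases (k : 'I_2) : k = 0 \/ k = 1.
Proof. by case: k => [[|[|n]] lt_n] //; [left | right]; apply: val_inj. Qed.

Lemma nth_part la i j :
  is_part la -> (i <= j)%N -> (nth 0 la j <= nth 0 la i)%N.
Proof.
move=> /andP[la_sorted _] le_ij.
have [lt_j|] := ltnP j (size la); last by move=> /(nth_default 0%N)->.
apply: (sorted_leq_nth geq_trans leqnn) => //.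
by rewrite inE // (leq_ltn_trans le_ij).
Qed.

Lemma nth_part_gt0 la i : is_part la -> (0 < nth 0 la i)%N = (i < size la)%N.
Proof.
move=> /andP[_ la0]; have [lt_i|] := ltnP i (size la); last first.
  by move=> /(nth_default 0%N)->.
rewrite lt0n; apply: contra la0 => /eqP <-; exact: mem_nth.
Qed.

Section Cells.
Variable la : seq nat.

Lemma cell_rowP (c : cell la) : (cell_row c < size la)%N.
Proof. exact: ltn_ord. Qed.

Lemma cell_colP (c : cell la) : (cell_col c < nth 0 la (cell_row c))%N.
Proof. exact: ltn_ord. Qed.

Lemma cell_inj (c d : cell la) :
  cell_row c = cell_row d -> cell_col c = cell_col d -> c = d.
Proof.
case: c d => [i j] [i' j'] eq_row; have eq_i : i = i' by apply: val_inj.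
by move: j' {eq_row}; case: i' / eq_i => j' /val_inj /= ->.
Qed.

Lemma cell_ex i j : (j < nth 0 la i)%N ->
  exists2 c : cell la, cell_row c = i & cell_col c = j.
Proof.
move=> lt_j; have lt_i : (i < size la)%N.
  by rewrite ltnNge; apply: contraL lt_j => /(nth_default 0%N) ->.
by exists (existT _ (Ordinal lt_i) (Ordinal lt_j)).
Qed.

Lemma big_cell (R : Type) (idx : R) (op : Monoid.com_law idx)
    (F : nat -> nat -> R) :
  \big[op/idx]_(c : cell la) F (cell_row c) (cell_col c)
  = \big[op/idx]_(i < size la) \big[op/idx]_(j < nth 0 la i) F i j.
Proof. by rewrite sig_big_dep. Qed.

Lemma card_cell_row r j :
  #|[set c : cell la | (cell_row c == r) && (cell_col c < j)%N]|
  = minn j (nth 0 la r).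
Proof.
rewrite -sum1dep_card big_mkcond /=.
rewrite (big_cell _ (fun a b => if (a == r) && (b < j)%N then 1%N else 0%N)).
have sum_ltn a : (\sum_(i < a) (if (i < j)%N then 1 else 0) = minn j a)%N.
  elim: a => [|a IH]; first by rewrite big_ord0 minn0.
  by rewrite big_ord_recr /= IH; case: ifP => H; lia.
have [lt_r|le_r] := ltnP r (size la).
  rewrite (bigD1 (Ordinal lt_r)) //= eqxx /= sum_ltn big1 ?addn0 // => i.
  by rewrite -val_eqE /= => /negbTE ir; rewrite big1 // => k _; rewrite ir.
rewrite nth_default // minn0 big1 // => i _; rewrite big1 // => k _.
by rewrite ltn_eqF //= (leq_trans (ltn_ord i)).
Qed.

Lemma card_cell : #|cell la| = sumn la.
Proof.
rewrite -sum1_card (big_cell _ (fun _ _ => 1%N)) sumnE (big_nth 0%N) big_mkord.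
by apply: eq_bigr => i _; rewrite sum1_card card_ord.
Qed.

Lemma sum_cell_row : (\sum_(c : cell la) cell_row c
  = \sum_(i < size la) i * nth 0 la i)%N.
Proof.
rewrite (big_cell _ (fun i _ => i)); apply: eq_bigr => i _.
by rewrite sum_nat_const card_ord mulnC.
Qed.

Lemma card_row r : #|[set c : cell la | cell_row c == r]| = nth 0 la r.
Proof.
rewrite -[RHS]minnn -card_cell_row; apply: eq_card => c; rewrite !inE.
by case: eqP => // <-; rewrite cell_colP.
Qed.

End Cells.

Section Tableaux.
Variables (la : seq nat) (N : nat).
Implicit Types (t : {ffun cell la -> 'I_N}) (c d : cell la).

Lemma ssytP t :
  reflect ((forall c d, cell_row c = cell_row d -> (cell_col c < cell_col d)%N ->
              (t c <= t d)%N) /\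
           (forall c d, cell_col c = cell_col d -> (cell_row c < cell_row d)%N ->
              (t c < t d)%N))
          (is_ssyt t).
Proof.
apply: (iffP forallP) => [H|[Hr Hc] c].
  split=> c d e l; have /forallP/(_ d)/andP[/implyP A /implyP B] := H c.
    by apply: A; rewrite e eqxx.
  by apply: B; rewrite e eqxx.
apply/forallP => d; apply/andP; split; apply/implyP => /andP[/eqP e l].
  exact: Hr.
exact: Hc.
Qed.

(** For semistandard [t] these numbers form its Gelfand-Tsetlin pattern: row [v] of the pattern is
    the shape occupied by the entries below [v]. *)
Definition cnt t (v r : nat) : nat :=
  #|[set c | (cell_row c == r) && (t c < v)%N]|.

Lemma cnt_leq t v w r : (v <= w)%N -> (cnt t v r <= cnt t w r)%N.
Proof.
move=> le_vw; apply/subset_leq_card/subsetP => c; rewrite !inE => /andP[-> h].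
exact: leq_trans h le_vw.
Qed.

Lemma cnt_le_row t v r : (cnt t v r <= nth 0 la r)%N.
Proof.
rewrite -card_row; apply/subset_leq_card/subsetP => c.
by rewrite !inE => /andP[].
Qed.

Lemma sum_cnt t v :
  (\sum_(r < size la) cnt t v r = #|[set c | (t c < v)%N]|)%N.
Proof.
rewrite -sum1dep_card (partition_big (fun c => tag c) predT) //=.
apply: eq_bigr => r _; rewrite /cnt -sum1dep_card; apply: eq_bigl => c.
by rewrite andbC.
Qed.

(** Rows increase weakly, so the entries below [v] fill an initial segment of each row; hence the
    pattern determines the tableau. *)
Lemma cnt_lt t v c : is_ssyt t ->
  (t c < v)%N = (cell_col c < cnt t v (cell_row c))%N.
Proof.
case/ssytP=> Hr _; apply/idP/idP => [lt_v|].
  have := card_cell_row la (cell_row c) (cell_col c).+1.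
  have /minn_idPl-> := cell_colP c; move=> <-.
  apply/subset_leq_card/subsetP => d; rewrite !inE => /andP[/eqP e].
  rewrite e eqxx ltnS leq_eqVlt => /predU1P[ec|lt_d] /=.
    by rewrite (cell_inj e ec).
  by rewrite (leq_ltn_trans (Hr _ _ e lt_d)).
apply: contraLR; rewrite -!leqNgt => le_v.
rewrite -[leqRHS](minn_idPl (ltnW (cell_colP c))) -card_cell_row.
apply/subset_leq_card/subsetP => d; rewrite !inE => /andP[/eqP e lt_d].
rewrite e eqxx ltnNge /= leq_eqVlt; apply/negP => /predU1P[ec|lt_c].
  by move: lt_d; rewrite -(cell_inj (esym e) ec) ltnNge le_v.
by move: (Hr _ _ (esym e) lt_c); lia.
Qed.

(** Column strictness: a cell of row [r.+1] with entry at most [v] lies under a cell with entry less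
    than [v]. *)
Lemma cnt_interlace t v r : is_part la -> is_ssyt t ->
  (cnt t v.+1 r.+1 <= cnt t v r)%N.
Proof.
move=> la_part t_ssyt; rewrite leqNgt; apply/negP => lt_cnt.
have lt_row : (cnt t v r < nth 0 la r.+1)%N.
  exact: leq_trans lt_cnt (cnt_le_row _ _ _).
have [d dr dc] := cell_ex lt_row.
have [c cr cc] := cell_ex (leq_trans lt_row (nth_part la_part (leqnSn r))).
have : (t d < v.+1)%N by rewrite cnt_lt // dr dc.
have : ~~ (t c < v)%N by rewrite cnt_lt // cr cc ltnn.
have : (t c < t d)%N.
  by case/ssytP: t_ssyt => _; apply; rewrite ?cr ?cc ?dr ?dc.
lia.
Qed.

Lemma ssyt_row_le t c : is_part la -> is_ssyt t -> (cell_row c <= t c)%N.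
Proof.
move=> la_part /ssytP[_ Hc]; move er : (cell_row c) => r.
elim: r c er => // r IH c er.
have [d dr dc] : exists2 d : cell la, cell_row d = r & cell_col d = cell_col c.
  apply: cell_ex; apply: leq_trans (cell_colP c) _; rewrite er.
  exact: nth_part la_part (leqnSn r).
by apply: leq_ltn_trans (IH d dr) _; apply: Hc; rewrite // dr er.
Qed.

Definition mult t (v : 'I_N) : nat := #|[set c | t c == v]|.

Lemma mult_cnt t (v : 'I_N) :
  (mult t v + \sum_(r < size la) cnt t v r = \sum_(r < size la) cnt t v.+1 r)%N.
Proof.
rewrite !sum_cnt /mult -cardsUI [X in (_ + #|pred_of_set X|)%N](_ : _ = set0).
  rewrite cards0 addn0; apply: eq_card => c; rewrite !inE -val_eqE /= ltnS.
  by rewrite -leq_eqVlt.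
by apply/setP => c; rewrite !inE -val_eqE /=; case: eqP => //= ->; rewrite ltnn.
Qed.

End Tableaux.

Section BenderKnuth.
Variables (la : seq nat) (N : nat) (i0 i1 : 'I_N).
Hypothesis la_part : is_part la.
Hypothesis i01 : i1 = i0.+1 :> nat.
Implicit Types (t : {ffun cell la -> 'I_N}) (c d : cell la).

(* Within row r the entries i0, i1 that are free to change fill the columns
   from bk_lo to bk_hi - 1; the involution reflects the boundary between the
   i0's and the i1's in this range. *)
Definition bk_lo t r := maxn (cnt t i0 r) (cnt t i1.+1 r.+1).
Definition bk_hi t r :=
  if r is s.+1 then minn (cnt t i1.+1 r) (cnt t i0 s) else cnt t i1.+1 0.
Definition bk_cut t r : nat := bk_lo t r + bk_hi t r - cnt t i1 r.

Definition bk t : {ffun cell la -> 'I_N} :=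
  [ffun c => if (i0 <= t c <= i1)%N then
               if (cell_col c < bk_cut t (cell_row c))%N then i0 else i1
             else t c].

(** The old boundary lies in the range in which it is reflected, so the subtraction in [bk_cut] is
    never truncated. *)
Lemma bk_bounds t r : is_ssyt t -> (bk_lo t r <= cnt t i1 r <= bk_hi t r)%N.
Proof.
move=> t_ssyt; rewrite /bk_lo geq_max cnt_leq ?cnt_interlace ?i01 //=.
case: r => [|r] /=; first by apply: cnt_leq; lia.
by rewrite leq_min cnt_interlace // andbT; apply: cnt_leq; lia.
Qed.

(** These are the inequalities by which the reflected row fits between the unchanged rows [i0] and
    [i1.+1] of the pattern. *)
Lemma bk_cut_bounds t r : is_ssyt t ->
  [/\ cnt t i0 r <= bk_cut t r, bk_cut t r <= cnt t i1.+1 r,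
      cnt t i1.+1 r.+1 <= bk_cut t r & bk_cut t r.+1 <= cnt t i0 r]%N.
Proof.
move=> t_ssyt; have := bk_bounds r t_ssyt; have := bk_bounds r.+1 t_ssyt.
rewrite /bk_cut /bk_lo /=; have : (bk_hi t r <= cnt t i1.+1 r)%N.
  by case: r => [|r] //=; rewrite geq_minl.
by split; lia.
Qed.

Lemma bk_lt_other t (v : nat) c :
  is_ssyt t -> v != i1 -> (bk t c < v)%N = (t c < v)%N.
Proof.
move=> t_ssyt vi1; rewrite /bk ffunE.
case: ifP => // /andP[h0 h1].
by case: ifP => _; lia.
Qed.

Lemma bk_lt t c : is_ssyt t ->
  (bk t c < i1)%N = (cell_col c < bk_cut t (cell_row c))%N.
Proof.
move=> t_ssyt; have [b1 b2 _ _] := bk_cut_bounds (cell_row c) t_ssyt.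
have h0 := cnt_lt i0 c t_ssyt; have h1 := cnt_lt i1.+1 c t_ssyt.
rewrite /bk ffunE; case: ifP => h; first by case: ifP => _; lia.
by move: h h0 h1; lia.
Qed.

Lemma bk_ssyt t : is_ssyt t -> is_ssyt (bk t).
Proof.
move=> t_ssyt; have /ssytP[Hr Hc] := t_ssyt; apply/ssytP; split=> c d.
  move=> e l; have le_t := Hr _ _ e l; rewrite leqNgt; apply/negP => lt_bk.
  (* Only comparison with [i1] can change, so an inversion forces [bk t c] to be [i1]; but the
     entries below [i1] again form an initial segment of the row. *)
  have [e1|ne1] := eqVneq (bk t c) i1; last first.
    move: (ne1) lt_bk; rewrite bk_lt_other // /bk ffunE.
    by do 2?case: ifP => ?; rewrite ?eqxx //; lia.
  move: lt_bk; rewrite e1 bk_lt // -e => lt_d.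
  have : (bk t c < i1)%N by rewrite bk_lt // (ltn_trans l).
  by rewrite e1 ltnn.
move=> e l; have lt_t := Hc _ _ e l.
have [/andP[c0 c1]|hc] := boolP (i0 <= t c <= i1)%N; last first.
  by rewrite /bk !ffunE (negbTE hc); do 2?case: ifP => ?; lia.
have [/andP[d0 d1]|hd] := boolP (i0 <= t d <= i1)%N; last first.
  by rewrite /bk !ffunE (negbTE hd); do 2?case: ifP => ?; lia.
(* A cell strictly between [c] and [d] would hold a value strictly between two elements of {[i0],
   [i1]}. *)
have er : cell_row d = (cell_row c).+1.
  apply/eqP; rewrite eqn_leq l andbT leqNgt; apply/negP => lt2.
  have [x xr xc] : exists2 x : cell la,
      cell_row x = (cell_row c).+1 & cell_col x = cell_col c.
    apply: cell_ex; rewrite e; apply: leq_trans (cell_colP d) _.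
    exact: nth_part la_part (ltnW lt2).
  have lt_cx : (t c < t x)%N by apply: Hc; rewrite ?xr ?xc.
  have lt_xd : (t x < t d)%N by apply: Hc; rewrite ?xr ?xc.
  lia.
have [_ _ b3 b4] := bk_cut_bounds (cell_row c) t_ssyt.
have h0 := cnt_lt i0 c t_ssyt; have h1 := cnt_lt i1.+1 d t_ssyt.
rewrite er -e in h1.
have : (bk t c < i1)%N by rewrite bk_lt //; lia.
have : ~~ (bk t d < i1)%N by rewrite bk_lt // er; lia.
lia.
Qed.

Lemma cnt_bk t v r : is_ssyt t ->
  cnt (bk t) v r = if v == i1 then bk_cut t r else cnt t v r.
Proof.
move=> t_ssyt; case: eqP => [->|/eqP ne]; last first.
  by apply: eq_card => c; rewrite inE [RHS]inE bk_lt_other.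
have /minn_idPl <- : (bk_cut t r <= nth 0 la r)%N.
  have [_ b2 _ _] := bk_cut_bounds r t_ssyt.
  exact: leq_trans b2 (cnt_le_row _ _ _).
rewrite -card_cell_row; apply: eq_card => c; rewrite !inE bk_lt //.
by case: eqP => // ->.
Qed.

(** The ends of the range depend only on rows [i0] and [i1.+1] of the pattern, which [bk] preserves,
    and row [i1] is reflected twice. *)
Lemma bkK t : is_ssyt t -> bk (bk t) = t.
Proof.
move=> t_ssyt; have bt_ssyt := bk_ssyt t_ssyt; apply/ffunP => c.
apply/val_inj; suff lt_iff v : (bk (bk t) c < v)%N = (t c < v)%N.
  apply/eqP; rewrite eqn_leq -ltnS lt_iff ltnS leqnn /=.
  by rewrite -ltnS -lt_iff ltnS.
rewrite !(cnt_lt _ _ _ ) ?bk_ssyt // !cnt_bk //; case: eqP => // ->.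
congr (_ < _)%N; set r := cell_row c.
have hi_bk : bk_hi (bk t) r = bk_hi t r.
  by rewrite /bk_hi; case: r => [|r]; rewrite !cnt_bk // i01 !ifN //; lia.
have lo_bk : bk_lo (bk t) r = bk_lo t r.
  by rewrite /bk_lo !cnt_bk // i01 !ifN //; lia.
rewrite {1}/bk_cut hi_bk lo_bk cnt_bk // eqxx /bk_cut.
have := bk_bounds r t_ssyt; lia.
Qed.

(** [bk_lo t r] and [bk_hi t r.+1] are the maximum and the minimum of the same two numbers
    [cnt t i0 r] and [cnt t i1.+1 r.+1], so the sum of all range ends telescopes. In terms of
    multiplicities, the numbers of [i0]'s and [i1]'s are exchanged. *)
Lemma sum_bk_cut t : is_ssyt t ->
  (\sum_(r < size la) bk_cut t r + \sum_(r < size la) cnt t i1 r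
   = \sum_(r < size la) cnt t i0 r + \sum_(r < size la) cnt t i1.+1 r)%N.
Proof.
move=> t_ssyt; rewrite -!big_split /=.
have -> : (\sum_(r < size la) (bk_cut t r + cnt t i1 r)
           = \sum_(r < size la) (bk_lo t r + bk_hi t r))%N.
  by apply: eq_bigr => r _; have := bk_bounds r t_ssyt; rewrite /bk_cut; lia.
have telescope n : (\sum_(r < n) (bk_lo t r + bk_hi t r)
   + (if n is s.+1 then minn (cnt t i1.+1 n) (cnt t i0 s) else cnt t i1.+1 0)
   = \sum_(r < n) (cnt t i0 r + cnt t i1.+1 r) + cnt t i1.+1 n)%N.
  elim: n => [|n IH]; first by rewrite !big_ord0.
  rewrite !big_ord_recr /=.
  case: n IH => [|n] /=; rewrite /bk_lo ?big_ord0; lia.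
have := telescope (size la).
have -> : cnt t i1.+1 (size la) = 0%N.
  by apply/eqP; rewrite -leqn0 -(nth_default 0%N (leqnn (size la))) cnt_le_row.
case: (size la) => [|n]; first by rewrite !big_ord0.
by rewrite min0n !addn0.
Qed.

Lemma mult_bk t v : is_ssyt t -> mult (bk t) (tperm i0 i1 v) = mult t v.
Proof.
move=> t_ssyt; have := mult_cnt (bk t) (tperm i0 i1 v); have := mult_cnt t v.
have sum_cut := sum_bk_cut t_ssyt.
have sumE w : (\sum_(r < size la) cnt (bk t) w r = if w == i1 :> nat then
    \sum_(r < size la) bk_cut t r else \sum_(r < size la) cnt t w r)%N.
  by case: ifP => e; apply: eq_bigr => r _; rewrite cnt_bk // e.
have [->|->|/eqP n0 /eqP n1] := tpermP i0 i1 v; rewrite !sumE.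
- rewrite eqxx ifN; last by lia.
  by have:= mult_cnt t i1; rewrite -i01; lia.
- rewrite -i01 eqxx ifN; last by lia.
  by have:= mult_cnt t i0; rewrite -i01; lia.
move: n0 n1; rewrite -!val_eqE /= => n0 n1.
by rewrite (negbTE n1) ifN; lia.
Qed.

End BenderKnuth.

Section Evaluation.
Variables (S : comPzRingType) (la : seq nat).

(** Permuting variables, setting a variable to 0 and substituting monomials all become changes of
    [y]. *)
Definition ev N (y : 'I_N -> S) : S :=
  \sum_(t : {ffun cell la -> 'I_N} | is_ssyt t) \prod_(c : cell la) y (t c).

Lemma eq_ev N (y z : 'I_N -> S) : y =1 z -> ev y = ev z.
Proof.
by move=> e; apply: eq_bigr => t _; apply: eq_bigr => c _; rewrite e.
Qed.

Lemma prod_mult N (y : 'I_N -> S) (t : {ffun cell la -> 'I_N}) :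
  \prod_(c : cell la) y (t c) = \prod_v y v ^+ mult t v.
Proof.
rewrite (partition_big t predT) //=; apply: eq_bigr => v _.
rewrite /mult -sum1dep_card -prodrXr; apply: eq_big => //.
by move=> c /eqP ->; rewrite expr1.
Qed.

Hypothesis la_part : is_part la.

Lemma ev_adjacent N (y : 'I_N -> S) (i0 i1 : 'I_N) :
  i1 = i0.+1 :> nat -> ev (y \o tperm i0 i1) = ev y.
Proof.
move=> i01; rewrite /ev.
rewrite (reindex_onto (bk i0 i1) (bk i0 i1)) /=; last by move=> t; apply: bkK.
rewrite (eq_bigl (fun t => is_ssyt t)); last first.
  move=> t; apply/andP/idP => [[H /eqP <-]|H]; first exact: bk_ssyt.
  by rewrite bk_ssyt ?bkK.
apply: eq_bigr => t t_ssyt; rewrite (prod_mult (y \o tperm i0 i1)) prod_mult.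
rewrite (reindex_inj (@perm_inj _ (tperm i0 i1))) /=; apply: eq_bigr => v _.
by rewrite /= tpermK mult_bk.
Qed.

Lemma ev_tperm N (y : 'I_N -> S) (i j : 'I_N) : ev (y \o tperm i j) = ev y.
Proof.
wlog lt_ij : i j / (i < j)%N.
  move=> H; case: (ltngtP i j) => [|lt_ji|e]; first exact: H.
    by rewrite tpermC H.
  by rewrite (val_inj e) tperm1; apply: eq_ev => k /=; rewrite perm1.
move: {2}(j - i)%N (leqnn (j - i)) => k.
elim: k i lt_ij y => [|k IH] i lt_ij y le_k.
  by lia.
have [e|ne] := eqVneq (j : nat) i.+1; first exact: ev_adjacent.
have lt_i1 : (i.+1 < N)%N by apply: leq_ltn_trans (ltn_ord j).
pose i1 := Ordinal lt_i1.
have lt_i1j : (i1 < j)%N by rewrite ltn_neqAle lt_ij eq_sym ne.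
(* Conjugating by an adjacent transposition shortens the distance between the two exchanged
   indices. *)
have -> : tperm i j = (tperm i i1 * tperm i1 j * tperm i i1)%g.
  have -> : (tperm i i1 * tperm i1 j * tperm i i1)%g = (tperm i1 j ^ tperm i i1)%g.
    by rewrite conjgE tpermV mulgA.
  rewrite tpermJ tpermR tpermD // -val_eqE /=; lia.
rewrite (eq_ev (z := ((y \o tperm i i1) \o tperm i1 j) \o tperm i i1)); last first.
  by move=> x; rewrite /= !permM.
rewrite ev_adjacent // IH //; first exact: ev_adjacent.
by rewrite /=; lia.
Qed.

Lemma ev_perm N (y : 'I_N -> S) (s : 'S_N) : ev (y \o s) = ev y.
Proof.
have [ts -> _] := prod_tpermP s; elim: ts y => [|[i j] ts IH] y.
  by rewrite big_nil; apply: eq_ev => x /=; rewrite perm1.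
rewrite big_cons -(IH y) -[RHS](ev_tperm _ i j).
by apply: eq_ev => x /=; rewrite permM.
Qed.

Lemma ev_perm_eq N (t1 t2 : N.-tuple S) :
  perm_eq t1 t2 -> ev (tnth t1) = ev (tnth t2).
Proof.
case/tuple_permP=> s /val_inj ->; rewrite -(ev_perm (tnth t2) s).
by apply: eq_ev => i; rewrite tnth_mktuple.
Qed.

End Evaluation.

(** * Homogeneous symmetric functions and plethysm *)

Section EvaluationExtra.
Variables (S : comPzRingType) (la : seq nat).

(** A tableau with an entry outside the image of [h] contributes 0. The others come from tableaux
    over ['I_K], because semistandardness only depends on the order of the entries. *)
Lemma ev_incl K N (h : 'I_K -> 'I_N) (y : 'I_N -> S) :
    {mono h : i j / (i <= j)%N} -> (forall i, i \notin codom h -> y i = 0) ->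
  ev la y = ev la (y \o h).
Proof.
move=> h_mono y0.
have h_ltn : {mono h : i j / (i < j)%N} by move=> i j; rewrite !ltnNge h_mono.
have h_inj : injective h.
  move=> i j eq_h; apply/val_inj/eqP; rewrite eqn_leq -!h_mono eq_h.
  by rewrite !leqnn.
pose hT (t : {ffun cell la -> 'I_K}) := [ffun c => h (t c)].
have hT_inj : injective hT.
  by move=> t u /ffunP e; apply/ffunP => c; have:= e c; rewrite !ffunE => /h_inj.
have hT_ssyt t : is_ssyt (hT t) = is_ssyt t.
  apply: eq_forallb => c; apply: eq_forallb => d.
  by rewrite !ffunE h_mono h_ltn.
rewrite /ev (bigID (mem (hT @: setT))) /= [X in _ + X]big1 ?addr0; last first.
  move=> t /andP[_ t_im]; have [c hc] : exists c, t c \notin codom h.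
    apply/existsP; rewrite -negb_forall; apply: contra t_im => /forallP H.
    apply/imsetP; exists [ffun c => iinv (H c)] => //.
    by apply/ffunP => c; rewrite !ffunE f_iinv.
  by rewrite (bigD1 c) //= y0 // mul0r.
transitivity (\sum_(t in hT @: [set t | is_ssyt t]) \prod_(c : cell la) y (t c)).
  apply: eq_bigl => t; apply/andP/imsetP => [[t_ssyt /imsetP[u _ e]]|[u]].
    by exists u => //; rewrite inE -hT_ssyt -e.
  by rewrite inE => u_ssyt ->; rewrite hT_ssyt imset_f.
rewrite big_imset /=; last by move=> ? ? _ _; apply: hT_inj.
by apply: eq_big => t; rewrite ?inE // => _; apply: eq_bigr => c _; rewrite ffunE.
Qed.

(** The number of variables is the length of the list, so lists of monomials can be permuted and
    filtered without casts between ordinal types. *)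
Definition evs (s : seq S) : S := ev la (fun i : 'I_(size s) => s`_i).

Lemma evsE N (s : seq S) : size s = N -> evs s = ev la (fun i : 'I_N => s`_i).
Proof. by case: N /. Qed.

Lemma perm_evs (s1 s2 : seq S) :
  is_part la -> perm_eq s1 s2 -> evs s1 = evs s2.
Proof.
move=> la_part eq_s; rewrite (evsE (perm_size eq_s)).
pose t1 := Tuple (introT eqP (perm_size eq_s)).
rewrite (eq_ev _ (z := tnth t1)) => [|i]; last by rewrite (tnth_nth 0).
rewrite (@ev_perm_eq _ _ la_part _ t1 (in_tuple s2)) //.
by apply: eq_ev => i; rewrite (tnth_nth 0).
Qed.

Lemma evs_cat0 (s : seq S) k : evs (s ++ nseq k 0) = evs s.
Proof.
have sz : size (s ++ nseq k 0) = (size s + k)%N by rewrite size_cat size_nseq.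
rewrite (evsE sz) (@ev_incl _ _ (@lshift _ k)) //.
  by apply: eq_ev => i; rewrite /= nth_cat ltn_ord.
move=> i i_codom; rewrite nth_cat; case: ifP => lt_i; last by rewrite nth_nseq if_same.
by case/codomP: i_codom; exists (Ordinal lt_i); apply: val_inj.
Qed.

End EvaluationExtra.

Lemma rmorph_ev (S T : comPzRingType) (f : {rmorphism S -> T}) la N
    (y : 'I_N -> S) : f (ev la y) = ev la (f \o y).
Proof.
by rewrite rmorph_sum; apply: eq_bigr => t _; rewrite rmorph_prod.
Qed.

Lemma rmorph_evs (S T : comPzRingType) (f : {rmorphism S -> T}) la s :
  f (evs la s) = evs la (map f s).
Proof.
rewrite (evsE _ (size_map f s)) /evs rmorph_ev; apply: eq_ev => i /=.
by rewrite (nth_map 0).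
Qed.

Lemma mcoeff_ev (R : comNzRingType) la K N (M : 'I_K -> 'X_{1..N}) m :
  (ev la (fun i => 'X_[R, M i]))@_m
  = #|[set t : {ffun cell la -> 'I_K} | is_ssyt t
        & (\sum_c M (t c))%MM == m]|%:R.
Proof.
rewrite -sum1dep_card natr_sum [LHS]raddf_sum [RHS]big_mkcondr /=.
apply: eq_bigr => t _.
by rewrite -(big_morph _ (@mpolyXD N R) (@mpolyX0 N R)) mcoeffX; case: eqP.
Qed.

Lemma schurE la N : schur la N = ev la (fun i : 'I_N => 'X_i).
Proof. by []. Qed.

Lemma plethysmE nu (G : symfun) N :
  plethysm (schur nu) G N = evs nu [seq 'X_[m] | m <- monomials (G N)].
Proof.
rewrite /plethysm /schur rmorph_sum (evsE nu (size_map _ _)).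
apply: eq_bigr => t _; rewrite rmorph_prod; apply: eq_bigr => c _.
by rewrite /= comp_mpolyXU.
Qed.

Lemma count_monomials N (p : {mpoly int[N]}) m :
  count_mem m (monomials p) = `|p@_m|%N.
Proof.
rewrite /monomials count_flatten -map_comp sumnE big_map.
rewrite (eq_bigr (fun k => ((k == m) * `|p@_m|)%N)); last first.
  by move=> k _; rewrite /= count_nseq /=; case: eqP => // ->.
have [m_in|m_out] := boolP (m \in msupp p).
  rewrite (bigD1_seq m) ?msupp_uniq //= eqxx mul1n big1 ?addn0 // => k.
  by move=> /negbTE ->.
rewrite big1_seq => [|k /= k_in]; first by move: m_out; rewrite -mcoeff_eq0 => /eqP->.
by case: eqP m_out => // <-; rewrite k_in.
Qed.

Section Restriction.
Variable N : nat.

(** [insub] fails only at the last index, which therefore receives the default 0. *)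
Definition restr_tuple : N.+1.-tuple {mpoly int[N]} :=
  [tuple oapp (fun j : 'I_N => 'X_j) 0 (insub (i : nat)) | i < N.+1].

(* The specialization x_N = 0. *)
Definition restr (p : {mpoly int[N.+1]}) : {mpoly int[N]} := p \mPo restr_tuple.

Definition mnmrestr (m : 'X_{1..N.+1}) : 'X_{1..N} :=
  [multinom m (widen_ord (leqnSn N) i) | i < N].

Lemma mnmwidenK : cancel (@mnmwiden N) mnmrestr.
Proof. by move=> m; apply/mnmP => i; rewrite mnmE mnmwiden_widen. Qed.

Lemma mnmrestrK (m : 'X_{1..N.+1}) : m ord_max = 0%N -> mnmwiden (mnmrestr m) = m.
Proof.
move=> m0; apply/mnmP => i; have [i'|] := unliftP ord_max i.
  move=> ->; have -> : lift ord_max i' = widen_ord (leqnSn N) i'.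
    by apply: val_inj; rewrite /= /bump leqNgt ltn_ord.
  by rewrite mnmwiden_widen mnmE.
by move=> ->; rewrite mnmwiden_ordmax m0.
Qed.

Lemma restrXU_widen (i : 'I_N) : restr 'X_(widen_ord (leqnSn N) i) = 'X_i.
Proof. by rewrite /restr comp_mpolyXU -tnth_nth tnth_mktuple /= valK. Qed.

Lemma restrXU_max : restr 'X_ord_max = 0.
Proof.
by rewrite /restr comp_mpolyXU -tnth_nth tnth_mktuple /= insubF //= ltnn.
Qed.

Lemma restrX m :
  restr 'X_[m] = if m ord_max == 0%N then 'X_[mnmrestr m] else 0.
Proof.
rewrite [in LHS]mpolyXE_id /restr rmorph_prod big_ord_recr /= !rmorphXn /=.
rewrite -/(restr _) restrXU_max expr0n; case: eqP => _; last by rewrite mulr0.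
rewrite mulr1 mpolyXE_id; apply: eq_bigr => i _.
by rewrite rmorphXn /= -/(restr _) restrXU_widen mnmE.
Qed.

Lemma mcoeff_restr p m : (restr p)@_m = p@_(mnmwiden m).
Proof.
rewrite /restr comp_mpolyEX raddf_sum [in RHS](mpolyE p) raddf_sum /=.
apply: eq_bigr => k _; rewrite !mcoeffZ mcoeffX -/(restr _) restrX.
congr (_ * _); have [k0|k0] := eqVneq (k ord_max) 0%N.
  rewrite mcoeffX; congr (_%:R); congr nat_of_bool; apply/eqP/eqP => [<-|->].
    by rewrite mnmrestrK.
  by rewrite mnmwidenK.
rewrite mcoeff0; case: eqP => // e; move: k0.
by rewrite e mnmwiden_ordmax.
Qed.

End Restriction.

(** Bundled as a ring morphism, the specialization passes through [ev] and [evs] by [rmorph_ev] and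
    [rmorph_evs]. *)
Lemma restr_rmorph N :
  {f : {rmorphism {mpoly int[N.+1]} -> {mpoly int[N]}} | f =1 @restr N}.
Proof. by exists (comp_mpoly (restr_tuple N)). Qed.

Lemma msym_rmorph N (s : 'S_N) :
  {f : {rmorphism {mpoly int[N]} -> {mpoly int[N]}} | f =1 msym s}.
Proof. by exists (msym s). Qed.

(* The second clause says that F N is obtained from F N.+1 by setting the last
   variable to 0. *)
Definition is_symfun (d : nat) (F : symfun) : Prop :=
  [/\ forall N (s : 'S_N), msym s (F N) = F N,
      forall N m, (F N.+1)@_(mnmwiden m) = (F N)@_m
    & forall N m, (F N)@_m != 0 -> mdeg m = d].

Local Notation "m # s" := [multinom m (s i) | i < _]
  (at level 40, left associativity, format "m # s").

Lemma mnm1_perm N (s : 'S_N) i : U_(i)%MM#(s^-1)%g = U_(s i)%MM.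
Proof.
apply/mnmP => j; rewrite mnmE !mnm1E; congr nat_of_bool.
by rewrite -(inj_eq (@perm_inj _ s)) permKV.
Qed.

Lemma schur_symfun la : is_part la -> is_symfun (sumn la) (schur la).
Proof.
move=> la_part; split=> [N s|N m|N m].
- have [f fE] := msym_rmorph s; rewrite -fE schurE rmorph_ev.
  rewrite -[RHS](ev_perm la_part _ s); apply: eq_ev => i.
  by rewrite /= fE msymX mnm1_perm.
- rewrite -mcoeff_restr; congr (_@__); have [f fE] := restr_rmorph N.
  rewrite -fE !schurE rmorph_ev (@ev_incl _ _ _ _ (widen_ord (leqnSn N))) //.
    by apply: eq_ev => i; rewrite /= fE restrXU_widen.
  move=> i i_codom; rewrite /= fE; suff -> : i = ord_max by rewrite restrXU_max.
  apply/val_inj/eqP; rewrite eqn_leq -ltnS ltn_ord /= leqNgt.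
  apply: contra i_codom => lt_i; apply/codomP.
  by exists (Ordinal lt_i); apply: val_inj.
rewrite schurE mcoeff_ev => ne0.
have /card_gt0P[t] : (0 < #|[set t : {ffun cell la -> 'I_N} | is_ssyt t
    & (\sum_c U_(t c))%MM == m]|)%N by rewrite lt0n; apply: contra ne0 => /eqP->.
rewrite inE => /andP[_ /eqP <-]; rewrite mdeg_sum -card_cell -sum1_card.
by apply: eq_bigr => c _; rewrite mdeg1.
Qed.

(** Permuting the variables only permutes the list of monomials of [G]. Setting the last variable to
    0 turns the monomials that contain it into zeros and leaves the list for one variable less; the
    zeros may be dropped. Each of the [sumn nu] cells contributes degree [d]. *)
Lemma plethysm_symfun nu d G : is_part nu -> is_symfun d G ->
  is_symfun (sumn nu * d) (plethysm (schur nu) G).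
Proof.
move=> nu_part [G_sym G_stable G_homog]; split=> [N s|N m|N m].
- have [f fE] := msym_rmorph s; rewrite -fE plethysmE rmorph_evs -map_comp.
  rewrite [X in evs nu X](_ : _ = map (fun m => 'X_[m])
     (map (fun m : 'X_{1..N} => m#(s^-1)%g) (monomials (G N)))); last first.
    by rewrite -map_comp; apply: eq_map => m; rewrite /= fE msymX.
  (* Equality up to order is checked on multiplicities, which are absolute values of coefficients of
     [G N] and so invariant under [s]. *)
  apply: perm_evs => //; apply: perm_map; apply/allP => m _ /=.
  rewrite count_map (eq_count (a2 := pred1 (m#s))).
    by rewrite !count_monomials -mcoeff_sym G_sym.
  by move=> k; apply: (can2_eq (mpermK s) (mpermKV s)).
- rewrite -mcoeff_restr; congr (_@__); have [f fE] := restr_rmorph N.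
  rewrite -fE !plethysmE rmorph_evs -map_comp.
  set L := monomials (G N.+1).
  pose a (m : 'X_{1..N.+1}) := m ord_max == 0%N.
  have eL : perm_eq (map (f \o (fun m => 'X_[m])) L)
     (map (fun m => 'X_[m]) (map (@mnmrestr N) (filter a L))
        ++ nseq (size (filter (predC a) L)) 0).
    rewrite perm_sym; apply: perm_trans (perm_map _ (permEl (perm_filterC a L))).
    rewrite map_cat -map_comp; apply/seq.permP => x; congr count; congr cat.
      apply/eq_in_map => k.
      by rewrite mem_filter /= fE restrX => /andP[/eqP-> _].
    rewrite -(size_map (f \o (fun m => 'X_[m]))); apply/esym/all_pred1P/allP.
    move=> z /mapP[k]; rewrite mem_filter /= => /andP[/negbTE k0 _] ->.
    by rewrite /= fE restrX -/(a k) k0.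
  rewrite (perm_evs nu_part eL) evs_cat0; apply: perm_evs => //.
  apply: perm_map; apply/allP => k _ /=.
  rewrite count_map count_filter count_monomials -G_stable -count_monomials.
  apply/eqP/eq_count => x /=; apply/andP/eqP => [[/eqP <- /eqP]|->].
    by move=> x0; rewrite mnmrestrK.
  by rewrite mnmwidenK /a mnmwiden_ordmax.
rewrite plethysmE (evsE nu (size_map _ _)).
set L := monomials (G N).
rewrite (eq_ev _ (z := fun i : 'I_(size L) => 'X_[tnth (in_tuple L) i])); last first.
  by move=> i; rewrite (nth_map 0%MM) // (tnth_nth 0%MM).
rewrite mcoeff_ev => ne0.
have /card_gt0P[t] : (0 < #|[set t : {ffun cell nu -> 'I_(size L)} | is_ssyt t
    & (\sum_c tnth (in_tuple L) (t c))%MM == m]|)%N.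
  by rewrite lt0n; apply: contra ne0 => /eqP->.
rewrite inE => /andP[_ /eqP <-]; rewrite mdeg_sum -card_cell -sum_nat_const.
apply: eq_bigr => c _; apply: (G_homog N).
have : tnth (in_tuple L) (t c) \in L by apply: mem_tnth.
by rewrite -has_pred1 has_count count_monomials absz_gt0.
Qed.

(** * Schur expansions *)

Definition pad N (la : seq nat) : 'X_{1..N} := [multinom nth 0%N la i | i < N].

Lemma symfun_pad F d N mu : is_symfun d F -> (size mu <= N)%N ->
  (F N)@_(pad N mu) = (F (size mu))@_(pad (size mu) mu).
Proof.
move=> [_ F_stable _]; elim: N => [|N IH].
  by rewrite leqn0 => /eqP->.
rewrite leq_eqVlt => /predU1P[<- //|]; rewrite ltnS => le_N.
rewrite -IH // -[RHS]F_stable; congr (_@__); apply/mnmP => i.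
have [->|/negbTE i_max] := eqVneq i ord_max.
  by rewrite mnmwiden_ordmax mnmE nth_default.
have lt_i : (i < N)%N.
  by have := ltn_ord i; rewrite ltnS leq_eqVlt -val_eqE /= in i_max *; rewrite i_max.
have -> : i = widen_ord (leqnSn N) (Ordinal lt_i) by apply: val_inj.
by rewrite mnmwiden_widen !mnmE.
Qed.

Lemma sorted_geq_filter_pos (s : seq nat) : sorted geq s ->
  s = [seq x <- s | (0 < x)%N] ++ nseq (size s - size [seq x <- s | (0 < x)%N]) 0%N.
Proof.
elim: s => // x s IH /= s_sorted; have {}IH := IH (path_sorted s_sorted).
have [x0|] := ltnP 0%N x; first by rewrite /= subSS -IH.
rewrite leqn0 => /eqP x0; move: s_sorted; rewrite x0 => s_path.
have -> : [seq y <- s | (0 < y)%N] = [::].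
  rewrite (eq_in_filter (a2 := pred0)) ?filter_pred0 // => y y_s.
  have /allP/(_ y y_s) /= := order_path_min geq_trans s_path.
  by rewrite leqn0 => /eqP->.
have /all_pred1P -> : all (pred1 0%N) s.
  by apply: sub_all (order_path_min geq_trans s_path) => y /=; rewrite leqn0.
by rewrite /= size_nseq.
Qed.

(** Sort the exponents and drop the zeros. Thus two symmetric functions agree as soon as their
    coefficients at partitions do. *)
Lemma mnm_partition N (m : 'X_{1..N}) : exists mu,
  [/\ mu \in partitions (mdeg m), (size mu <= N)%N &
      forall d F, is_symfun d F -> (F N)@_m = (F N)@_(pad N mu)].
Proof.
pose s := sort geq m; have s_sorted : sorted geq s.
  by apply: sort_sorted => a b; apply: leq_total.
have s_perm : perm_eq s m by rewrite perm_sort.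
have s_size : size s = N by rewrite (perm_size s_perm) size_tuple.
have eq_s := sorted_geq_filter_pos s_sorted.
set mu := [seq x <- s | (0 < x)%N] in eq_s; exists mu.
have mu_size : (size mu <= N)%N by rewrite -s_size size_filter count_size.
split=> //.
  rewrite mem_partitions /is_part (sorted_filter geq_trans) // mem_filter /=.
  apply/eqP; rewrite mdegE.
  have <- : sumn s = sumn mu by rewrite {1}eq_s sumn_cat sumn_nseq mul0n addn0.
  by rewrite sumnE (perm_big _ s_perm) /= big_tuple.
move=> d F [F_sym _ _].
have nth_mu i : nth 0%N mu i = nth 0%N s i.
  by rewrite eq_s nth_cat nth_nseq if_same; case: ltnP => // /(nth_default 0%N).
have pad_perm : perm_eq (pad N mu) m.
  apply: perm_trans s_perm; apply/seq.permP => a; congr count.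
  apply: (@eq_from_nth _ 0%N); rewrite size_tuple // => i lt_i.
  by rewrite -nth_mu -(tnth_nth _ _ (Ordinal lt_i)) tnth_mktuple.
have /tuple_permP[p eq_p] := pad_perm.
rewrite -{1}(F_sym N p) mcoeff_sym; congr (_@__).
apply/mnmP => i; have : tnth (pad N mu) i = tnth m (p i).
  by rewrite (tnth_nth 0%N) eq_p -tnth_nth tnth_mktuple.
by rewrite mnmE.
Qed.

Definition kostka (la mu : seq nat) : int :=
  (schur la (size mu))@_(pad (size mu) mu).

(** The statistic usually written n(la): with entries counted from 0, it is the sum of entries of
    the tableau of shape [la] whose entries are their row indices. It is a numerical rank used in
    place of the dominance order. *)
Definition nrank (la : seq nat) : nat := \sum_(i < size la) i * nth 0%N la i.

Lemma mcoeff_schur la N m : (schur la N)@_m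
  = #|[set t : {ffun cell la -> 'I_N} | is_ssyt t
        & (\sum_c U_(t c))%MM == m]|%:R.
Proof. by rewrite schurE mcoeff_ev. Qed.

Lemma content_mult la N (t : {ffun cell la -> 'I_N}) i :
  (\sum_c U_(t c))%MM i = mult t i.
Proof.
rewrite mnm_sumE /mult -sum1dep_card [RHS]big_mkcond /=.
by apply: eq_bigr => c _; rewrite mnm1E.
Qed.

Lemma sum_entries la N (t : {ffun cell la -> 'I_N}) :
  (\sum_c t c = \sum_(i < N) i * mult t i)%N.
Proof.
rewrite (partition_big t predT) //=; apply: eq_bigr => i _.
rewrite (eq_bigr (fun=> i : nat)); last by move=> c /eqP->.
by rewrite sum_nat_cond_const mulnC.
Qed.

(** An entry is at least its row index, so the sum of entries, which the content [mu] fixes as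
    [nrank mu], is at least [nrank la]. Equality makes every entry equal to its row index, and then
    shape and content coincide. *)
Lemma kostka_triangular la mu : is_part la -> is_part mu ->
  kostka la mu != 0 -> la = mu \/ (nrank la < nrank mu)%N.
Proof.
move=> la_part mu_part; rewrite /kostka mcoeff_schur.
set T := [set t | _]; have [->|[t]] := set_0Vmem T; first by rewrite cards0.
rewrite inE => /andP[t_ssyt /eqP t_content] _.
have tE i : mult t i = nth 0%N mu i by rewrite -content_mult t_content mnmE.
have -> : nrank mu = (\sum_c t c)%N.
  by rewrite sum_entries; apply: eq_bigr => i _; rewrite tE.
rewrite /nrank -sum_cell_row.
have leif := leqif_sum (fun c (_ : true) => leqif_eq (ssyt_row_le c la_part t_ssyt)).
have [lt|ge] := ltnP; [by right | left].
have t_row c : t c = cell_row c :> nat.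
  by have := ge; rewrite (geq_leqif leif) => /forallP/(_ c)/eqP.
have eq_nth i : nth 0%N la i = nth 0%N mu i.
  rewrite -card_row; have [lt_i|le_i] := ltnP i (size mu).
    rewrite -(tE (Ordinal lt_i)); apply: eq_card => c.
    by rewrite !inE -val_eqE /= t_row.
  rewrite nth_default //; apply/eqP; rewrite cards_eq0; apply/eqP/setP => c.
  by rewrite !inE -t_row ltn_eqF // (leq_trans (ltn_ord _)).
have eq_size : size la = size mu.
  apply/eqP; rewrite eqn_leq; apply/andP; split; rewrite leqNgt.
    by rewrite -nth_part_gt0 // eq_nth nth_default.
  by rewrite -nth_part_gt0 // -eq_nth nth_default.
by apply: (@eq_from_nth _ 0%N).
Qed.

Lemma kostka_diag la : is_part la -> kostka la la = 1.
Proof.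
move=> la_part; rewrite /kostka mcoeff_schur.
pose t0 : {ffun cell la -> 'I_(size la)} := [ffun c => tag c].
have -> : [set t | is_ssyt t & (\sum_c U_(t c))%MM == pad (size la) la] = [set t0].
  apply/setP => t; rewrite !inE; apply/andP/eqP => [[t_ssyt /eqP t_content]|->].
    have leif := leqif_sum (fun c (_ : true) => leqif_eq (ssyt_row_le c la_part t_ssyt)).
    have : (\sum_c t c <= \sum_(c : cell la) cell_row c)%N.
      rewrite sum_cell_row sum_entries; apply: leq_sum => i _.
      by rewrite -content_mult t_content mnmE.
    rewrite (geq_leqif leif) => /forallP H; apply/ffunP => c.
    by apply/val_inj; rewrite /= ffunE -(eqP (H c)).
  split.
    by apply/ssytP; split=> c d; rewrite !ffunE // => e _; rewrite -/(cell_row c) e.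
  apply/eqP/mnmP => i; rewrite content_mult mnmE -card_row.
  by apply: eq_card => c; rewrite !inE ffunE.
by rewrite cards1.
Qed.

(** Forward substitution by increasing rank; the diagonal is 1, so it works over the integers, and
    distinct elements of equal rank do not interact. *)
Lemma triangular_solve (T : eqType) (s : seq T) (K : T -> T -> int)
    (rank : T -> nat) (f : T -> int) :
    uniq s -> {in s, forall x, K x x = 1} ->
    {in s &, forall x y, K x y != 0 -> x = y \/ (rank x < rank y)%N} ->
  exists c : T -> int, {in s, forall y, \sum_(x <- s) c x * K x y = f y}.
Proof.
move=> s_uniq K1 K_tri.
suff [c Hc] : exists c : T -> int, {in s, forall y,
    (rank y < (\max_(x <- s) rank x).+1)%N -> \sum_(x <- s) c x * K x y = f y}.
  by exists c => y y_s; apply: Hc => //; rewrite ltnS (leq_bigmax_seq _ y_s).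
elim: _.+1 => [|k [c Hc]]; first by exists (fun=> 0).
pose e y := f y - \sum_(x <- s | (rank x < k)%N) c x * K x y.
(* At rank [k] the new coefficient is the defect [e] left by the lower ranks; coefficients of higher
   rank do not affect the equations up to rank [k]. *)
exists (fun x => if (rank x < k)%N then c x else
                 if rank x == k then e x else 0) => y y_s; rewrite ltnS => le_y.
have K0 x : x \in s -> (rank y <= rank x)%N -> x != y -> K x y = 0.
  move=> x_s le_xy ne_xy; apply/eqP/contraT => /(K_tri _ _ x_s y_s)[e_xy|].
    by rewrite e_xy eqxx in ne_xy.
  by rewrite ltnNge le_xy.
rewrite (bigID (fun x => (rank x < k)%N)) /=.
rewrite (eq_bigr (fun x => c x * K x y)) => [|x ->] //.
have [lt_y|ge_y] := ltnP (rank y) k.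
  rewrite -[RHS](Hc y y_s lt_y) [RHS](bigID (fun x => (rank x < k)%N)) /=.
  have tail0 (g : T -> int) : \sum_(x <- s | ~~ (rank x < k)%N) g x * K x y = 0.
    rewrite big_seq_cond big1 // => x /andP[x_s]; rewrite -leqNgt => le_x.
    rewrite K0 ?mulr0 //; first by apply: leq_trans le_x; apply: ltnW.
    by apply: contraTneq le_x => ->; rewrite -ltnNge.
  by rewrite !tail0.
rewrite [X in _ + X]big_mkcond (bigD1_seq y) //=.
rewrite ltnNge ge_y /= eqn_leq le_y ge_y /= K1 // mulr1.
rewrite [X in e y + X]big_seq_cond [X in e y + X]big1 ?addr0 => [|x /andP[x_s ne_x]].
  by rewrite /e addrC subrK.
case: ltnP => //= le_x; rewrite K0 ?mulr0 //; exact: leq_trans le_y le_x.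
Qed.

(** The system is solved once, with the equation for [mu] read in [size mu] variables; stability of
    coefficients under adding variables makes one [c] serve every [N]. *)
Lemma schur_expansion_ex F d : is_symfun d F ->
  exists c, schur_expansion F d c.
Proof.
move=> F_sym.
have part_of la : la \in partitions d -> is_part la.
  by rewrite mem_partitions => /andP[].
have [c Hc] := @triangular_solve _ (partitions d) kostka nrank
  (fun mu => (F (size mu))@_(pad (size mu) mu)) (partitions_uniq d)
  (fun la h => kostka_diag (part_of _ h))
  (fun la mu h h' => kostka_triangular (part_of _ h) (part_of _ h')).
have sum_la la : la \in partitions d -> is_symfun d (schur la).
  rewrite mem_partitions => /andP[la_part /eqP <-]; exact: schur_symfun.
exists c => N; apply/mpolyP => m; rewrite raddf_sum /= big_seq.
under eq_bigr do rewrite mcoeffZ.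
have [deg_m|deg_m] := eqVneq (mdeg m) d; last first.
  have F0 G : is_symfun d G -> (G N)@_m = 0.
    by move=> [_ _ H]; apply: contraNeq deg_m => /H /eqP.
  by rewrite F0 // big1 // => la /sum_la/F0->; rewrite mulr0.
have [mu [mu_part mu_size Hmu]] := mnm_partition m.
rewrite deg_m in mu_part.
rewrite (Hmu _ _ F_sym) (symfun_pad F_sym) // -Hc // [LHS]big_seq.
apply: eq_bigr => la /sum_la la_sym.
by rewrite (Hmu _ _ la_sym) (symfun_pad la_sym).
Qed.

(** * Coefficients of two-row shapes *)

Lemma content_pad2 la (t : {ffun cell la -> 'I_2}) i j : sumn la = (i + j)%N ->
  ((\sum_c U_(t c))%MM == pad 2 [:: i; j]) = (mult t 0 == i).
Proof.
move=> la_sum; have : (mult t 0%R + mult t 1%R = i + j)%N.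
  rewrite -la_sum -card_cell -cardsUI [X in (_ + #|pred_of_set X|)%N](_ : _ = set0).
    rewrite cards0 addn0 -cardsT; apply: eq_card => c; rewrite !inE.
    by case: (t c) => [[|[|n]]] //=.
  apply/setP => c; rewrite !inE; case: eqP => // ->.
  by rewrite -val_eqE.
move=> mult_sum; apply/eqP/eqP => [/mnmP/(_ 0)|mult0].
  by rewrite content_mult mnmE.
apply/mnmP => k; rewrite content_mult mnmE.
have [->|->] := ord2_cases k; rewrite /=; lia.
Qed.

(** With entries 0 and 1 there are at most two rows, the second all 1, and the first consists of [i]
    zeros followed by ones. So there is at most one tableau, and column strictness requires the
    zeros to cover the second row. *)
Lemma mcoeff_schur2 la i j : is_part la -> sumn la = (i + j)%N ->
  (schur la 2)@_(pad 2 [:: i; j])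
  = ((size la <= 2) && (nth 0 la 1 <= i <= nth 0 la 0))%N%:R.
Proof.
move=> la_part la_sum; rewrite mcoeff_schur.
pose t0 : {ffun cell la -> 'I_2} :=
  [ffun c => if (cell_row c == 0%N) && (cell_col c < i)%N then 0 else 1].
set T := [set t | _]; set b := (_ && _).
have T_sub t : t \in T -> t = t0 /\ b.
  rewrite inE content_pad2 // => /andP[t_ssyt /eqP t_mult].
  have le_t c := ssyt_row_le c la_part t_ssyt.
  have row_lt2 (c : cell la) : (cell_row c < 2)%N.
    exact: leq_ltn_trans (le_t c) (ltn_ord _).
  have cntE : cnt t 1 0 = i.
    rewrite -t_mult; apply: eq_card => c; rewrite !inE -val_eqE /=.
    have := le_t c; rewrite ltnS leqn0 andbC.
    by case: eqP => //= ->; rewrite leqn0 => ->.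
  have t_lt1 (c : cell la) : (t c < 1)%N = (cell_row c == 0%N) && (cell_col c < i)%N.
    rewrite -cntE; case: eqP => [e|ne] /=; first by rewrite cnt_lt // e.
    apply/negbTE; rewrite -leqNgt (leq_trans _ (le_t c)) // lt0n; exact/eqP.
  split.
    apply/ffunP => c; apply/val_inj; rewrite ffunE -t_lt1.
    by case: (t c) => [[|[|n]] lt_n].
  apply/and3P; split; last by rewrite -cntE cnt_le_row.
    rewrite leqNgt; apply/negP => lt_size.
    have [c cr _] : exists2 c : cell la, cell_row c = 2%N & cell_col c = 0%N.
      by apply: cell_ex; rewrite nth_part_gt0.
    by have := row_lt2 c; rewrite cr.
  rewrite leqNgt; apply/negP => lt_i; have [d dr dc] := cell_ex lt_i.
  have [c cr cc] := cell_ex (leq_trans lt_i (nth_part la_part (leq0n 1))).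
  have : ~~ (t c < 1)%N by rewrite t_lt1 cr cc ltnn.
  have : (t c < t d)%N by case/ssytP: t_ssyt => _; apply; rewrite ?cr ?cc ?dr ?dc.
  by have := ltn_ord (t d); lia.
case: (boolP b) => [/and3P[la_size le1 le0]|nb] /=; last first.
  have -> : T = set0; last by rewrite cards0.
  by apply/setP => t; rewrite in_set0; apply: contraNF nb => /T_sub[].
suff -> : T = [set t0] by rewrite cards1.
apply/setP => t; rewrite !in_set1; apply/idP/eqP => [/T_sub[]//|->].
rewrite inE content_pad2 //; apply/andP; split; last first.
  rewrite -[X in _ == X](minn_idPl le0) -card_cell_row; apply/eqP/eq_card => c.
  by rewrite !inE ffunE; case: ifP.
apply/ssytP; split=> c d; rewrite !ffunE.
  by move=> <- lt_cd; do 2?case: ifP => //; lia.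
move=> e lt_cd; have := cell_rowP d; have := cell_colP d => lt_col lt_row.
have dr : cell_row d = 1%N by lia.
have cr : cell_row c = 0%N by lia.
by rewrite dr cr /= e (leq_trans _ le1) // -dr.
Qed.

Lemma sumn_two_row a b : sumn (two_row a b) = (a + b)%N.
Proof. by rewrite /two_row /=; case: a => [|a]; case: b => [|b] //=; lia. Qed.

Lemma is_part_two_row a b : (b <= a)%N -> is_part (two_row a b).
Proof.
move=> le_ba; rewrite /is_part /two_row /=.
by do 2!case: ltnP => ? /=; rewrite ?inE; lia.
Qed.

Lemma two_rowP la d r : is_part la -> sumn la = d -> (r + r <= d)%N ->
  ((size la <= 2)%N && (nth 0%N la 1 == r)) = (la == two_row (d - r) r).
Proof.
rewrite /two_row /is_part; case: la => [|a [|b [|c la]]] /=.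
- by move=> _ <-; rewrite leqn0 addn_eq0 => /andP[/eqP-> _].
- rewrite inE addn0 => a0 <-; case: r => [|r] le_r /=.
    by rewrite subn0; case: ltnP => [_|]; [rewrite !eqxx | lia].
  by case: ltnP => [_|]; [rewrite eqseq_cons /= andbF | lia].
- rewrite !inE addn0 => /andP[ge_ab ab0] <- le_r.
  apply/eqP/eqP => [<-|].
    by rewrite addnK; have [-> ->] : (0 < a)%N /\ (0 < b)%N by lia.
  by do 2!case: ltnP => ? //=; case.
by move=> _ _ _; apply/esym/eqP => /(congr1 size); case: ifP; case: ifP.
Qed.

Lemma two_row_partition d r : (r + r <= d)%N ->
  two_row (d - r) r \in partitions d.
Proof.
move=> le_r; rewrite mem_partitions is_part_two_row ?sumn_two_row; last by lia.
by rewrite subnK //; lia.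
Qed.

(* In two variables s_(a,b) is the sum of all monomials x^i y^(a+b-i) with
   b <= i <= a, so multiplying by 1 - y/x isolates the coefficient wanted. *)
Lemma schur_coef_two_row F d r : is_symfun d F -> (r + r <= d)%N ->
  schur_coef F d (two_row (d - r) r)
  = (F 2)@_(pad 2 [:: (d - r)%N; r])
    - (if r is s.+1 then (F 2)@_(pad 2 [:: (d - s)%N; s]) else 0).
Proof.
move=> F_sym le_r; rewrite /schur_coef.
have := epsilon_spec (inhabits (fun=> 0)) (schur_expansion F d)
  (schur_expansion_ex F_sym).
set c := epsilon _ _ => Hc.
(* Since [s <= d - s] and the two parts add up to [d], the bounds
   [nth 0 la 1 <= d - s <= nth 0 la 0] reduce to [nth 0 la 1 <= s]. Consecutive values of [s] then
   differ by the shapes whose second part is exactly the larger one. *)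
have FE s : (s <= r)%N -> (F 2)@_(pad 2 [:: (d - s)%N; s])
    = \sum_(la <- partitions d) c la * ((size la <= 2) && (nth 0 la 1 <= s))%N%:R.
  move=> le_s; rewrite Hc raddf_sum /= !big_seq; apply: eq_bigr => la.
  rewrite mem_partitions => /andP[la_part /eqP la_sum].
  rewrite mcoeffZ mcoeff_schur2 //; last by rewrite la_sum subnK //; lia.
  congr (_ * _%:R); congr nat_of_bool; case: leqP => //= la_size.
  have : (nth 0 la 0 + nth 0 la 1 = d)%N.
    by case: (la) la_sum la_size => [|a [|b [|e la']]] //=; rewrite ?addn0 ?addnA.
  have := nth_part la_part (leq0n 1).
  lia.
transitivity (\sum_(la <- partitions d)
    c la * ((size la <= 2)%N && (nth 0%N la 1 == r))%:R).
  rewrite (bigD1_seq (two_row (d - r) r)) ?partitions_uniq ?two_row_partition //=.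
  have := two_row_partition le_r; rewrite mem_partitions => /andP[tr_part /eqP tr_sum].
  rewrite (two_rowP tr_part tr_sum le_r) eqxx mulr1 big_seq_cond big1 ?addr0 // => la.
  rewrite mem_partitions => /andP[/andP[la_part /eqP la_sum] /negbTE ne].
  by rewrite (two_rowP la_part la_sum le_r) ne mulr0.
rewrite FE //; case: r {le_r} FE => [|r] FE.
  by rewrite subr0; apply: eq_bigr => la _; rewrite leqn0.
rewrite FE // -sumrB; apply: eq_bigr => la _; rewrite -mulrBr; congr (_ * _).
case: (size la <= 2)%N; rewrite ?subrr //=.
case: (ltngtP (nth 0%N la 1) r.+1) => [|?|->]; rewrite ?ltnS ?ltnn //.
  by move=> ->.
by rewrite leqNgt ltnW.
Qed.

(** * Power series and counting partitions *)

Lemma fps_polyM (p q : {poly int}) :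
  fps_poly (p * q) = fps_mul (fps_poly p) (fps_poly q).
Proof. by apply: functional_extensionality => r; rewrite /fps_poly coefM. Qed.

(* The coefficient of z^r in a product only involves the truncations at r, so
   the ring laws are inherited from polynomials. *)
Definition fps_trunc (K : nat) (f : fps) : {poly int} := \poly_(i < K) f i.

Lemma fps_trunc_eq K f r : (r < K)%N -> fps_poly (fps_trunc K f) r = f r.
Proof. by move=> lt_r; rewrite /fps_poly coef_poly lt_r. Qed.

Lemma eq_fps_mul (f f' g g' : fps) r :
    (forall i, (i <= r)%N -> f i = f' i) -> (forall i, (i <= r)%N -> g i = g' i) ->
  fps_mul f g r = fps_mul f' g' r.
Proof.
move=> ff gg; apply: eq_bigr => i _.
by rewrite ff ?gg ?leq_subr // -ltnS.
Qed.

Lemma fps_mulC : commutative fps_mul.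
Proof.
move=> f g; apply: functional_extensionality => r.
have E h i : (i <= r)%N -> h i = fps_poly (fps_trunc r.+1 h) i.
  by move=> le_i; rewrite fps_trunc_eq.
rewrite (eq_fps_mul (E f) (E g)) (eq_fps_mul (E g) (E f)).
by rewrite -!fps_polyM mulrC.
Qed.

Lemma fps_mulA : associative fps_mul.
Proof.
move=> f g h; apply: functional_extensionality => r.
have E k i : (i <= r)%N -> k i = fps_poly (fps_trunc r.+1 k) i.
  by move=> le_i; rewrite fps_trunc_eq.
have EM k l i : (i <= r)%N -> fps_mul k l i
    = fps_mul (fps_poly (fps_trunc r.+1 k)) (fps_poly (fps_trunc r.+1 l)) i.
  by move=> le_i; apply: eq_fps_mul => j le_j; apply: E; apply: leq_trans le_i.
rewrite (eq_fps_mul (E f) (EM g h)) (eq_fps_mul (EM f g) (E h)).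
by rewrite -!fps_polyM mulrA.
Qed.

Lemma fps_mul1 : left_id (fps_poly 1) fps_mul.
Proof.
move=> f; apply: functional_extensionality => r; rewrite /fps_mul big_ord_recl.
rewrite /fps_poly coef1 mul1r subn0 big1 ?addr0 // => i _.
by rewrite coef1 mul0r.
Qed.

HB.instance Definition _ :=
  Monoid.isComLaw.Build fps (fps_poly 1) fps_mul fps_mulA fps_mulC fps_mul1.

Lemma fps_inv_unique f g : f 0%N \is a GRing.unit ->
  fps_mul f g = fps_poly 1 -> fps_inv f = g.
Proof.
move=> f0 fg; have Vf : fps_mul (fps_inv f) f = fps_poly 1.
  exact: functional_extensionality (fps_mulVr f0).
by rewrite -[g]fps_mul1 -Vf -fps_mulA fg [RHS]fps_mulC fps_mul1.
Qed.

Lemma fps_invM (p q : {poly int}) : p`_0 = 1 -> q`_0 = 1 ->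
  fps_inv (fps_poly (p * q)) = fps_mul (fps_inv (fps_poly p)) (fps_inv (fps_poly q)).
Proof.
move=> p0 q0; have inv1 (s : {poly int}) : s`_0 = 1 ->
    fps_mul (fps_inv (fps_poly s)) (fps_poly s) = fps_poly 1.
  move=> s0; apply: functional_extensionality; apply: fps_mulVr.
  by rewrite /fps_poly s0 unitr1.
apply: fps_inv_unique; first by rewrite /fps_poly coef0M p0 q0 mulr1 unitr1.
rewrite fps_polyM [fps_mul (fps_inv _) _]fps_mulC fps_mulA.
rewrite -(fps_mulA (fps_poly p)) [fps_mul (fps_poly q) _]fps_mulC inv1 //.
by rewrite [fps_mul _ (fps_poly 1)]fps_mulC fps_mul1 fps_mulC inv1.
Qed.

Lemma coef0_1subXn i : (0 < i)%N -> (1 - 'X^i : {poly int})`_0 = 1.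
Proof. by case: i => // i _; rewrite coefB coef1 coefXn subr0. Qed.

Lemma coef0_prod_1subXn a b : (0 < a)%N ->
  (\prod_(a <= i < b) (1 - 'X^i) : {poly int})`_0 = 1.
Proof.
move=> a0; rewrite -horner_coef0 horner_prod big_nat big1 // => i /andP[le_ai _].
by rewrite horner_coef0 coef0_1subXn // (leq_trans a0).
Qed.

Lemma fps_inv_prod b :
  fps_inv (fps_poly (\prod_(1 <= i < b.+1) (1 - 'X^i))) = P_upto b.
Proof.
rewrite /P_upto; elim: b => [|b IH].
  by rewrite !big_nil; apply: fps_inv_unique; rewrite ?fps_mul1 // /fps_poly coef1.
rewrite [in LHS]big_nat_recr // [in RHS]big_nat_recr //=.
rewrite fps_invM ?coef0_prod_1subXn ?coef0_1subXn //.
by rewrite IH.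
Qed.

Lemma fps_mul_polyr f (p : {poly int}) r :
  fps_mul f (fps_poly p) r = (fps_trunc r.+1 f * p)`_r.
Proof.
rewrite -[RHS]/(fps_poly _ r) fps_polyM; apply: eq_fps_mul => // i le_i.
by rewrite fps_trunc_eq.
Qed.

Lemma fps_mulXn f k r :
  fps_mul f (fps_poly 'X^k) r = if (k <= r)%N then f (r - k)%N else 0.
Proof.
rewrite fps_mul_polyr coefMXn ltnNge; case: (k <= r)%N => //=.
by rewrite coef_poly ltnS leq_subr.
Qed.

Lemma fps_mul_1subXn f k r : fps_mul f (fps_poly (1 - 'X^k)) r
  = f r - (if (k <= r)%N then f (r - k)%N else 0).
Proof.
rewrite fps_mul_polyr mulrBr mulr1 coefB -fps_mul_polyr fps_mulXn.
by rewrite coef_poly ltnSn.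
Qed.

(** Multiplying [P_upto b.+1] by its last denominator gives back [P_upto b]. The form is chosen to
    match [size_monoseqs_recl]. *)
Lemma P_upto_recl b r : P_upto b.+1 r
  = P_upto b r + (if (b < r)%N then P_upto b.+1 (r - b.+1)%N else 0).
Proof.
have -> : P_upto b = fps_mul (P_upto b.+1) (fps_poly (1 - 'X^(b.+1))).
  rewrite /P_upto [in RHS]big_nat_recr //= -fps_mulA.
  have -> : fps_mul (fps_inv (fps_poly (1 - 'X^(b.+1)))) (fps_poly (1 - 'X^(b.+1)))
      = fps_poly 1.
    apply: functional_extensionality; apply: fps_mulVr.
    by rewrite /fps_poly coef0_1subXn // unitr1.
  by rewrite fps_mulC fps_mul1.
by rewrite fps_mul_1subXn subrK.
Qed.

(** Partitions of [r] into at most [b] parts, padded with zeros to length [b] and listed in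
    increasing order, as in a row of a tableau. *)
Definition monoseqs (b r : nat) : seq (seq nat) :=
  [seq s <- [seq map val (t : seq 'I_r.+1) | t : b.-tuple 'I_r.+1]
         | sorted leq s & sumn s == r].

Lemma leq_sumn (s : seq nat) x : x \in s -> (x <= sumn s)%N.
Proof. by move=> x_s; rewrite sumnE (big_rem x) //= leq_addr. Qed.

Lemma mem_monoseqs b r s :
  (s \in monoseqs b r) = [&& sorted leq s, size s == b & sumn s == r].
Proof.
rewrite mem_filter; apply/andP/and3P => [[/andP[-> ->] /mapP[t _ ->]]|].
  by rewrite size_map size_tuple.
move=> [s_sorted /eqP s_size s_sum]; rewrite s_sorted; split=> //.
have sz : size (map (fun x => inord x : 'I_r.+1) s) == b.
  by rewrite size_map s_size.
apply/mapP; exists (Tuple sz); first by rewrite mem_enum.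
rewrite /= -map_comp -[LHS]map_id; apply/eq_in_map => x x_s /=.
by rewrite inordK // ltnS -(eqP s_sum) leq_sumn.
Qed.

Lemma monoseqs_uniq b r : uniq (monoseqs b r).
Proof.
rewrite filter_uniq // map_inj_uniq ?enum_uniq // => s t /(inj_map val_inj).
exact: val_inj.
Qed.

Lemma sumn_map_succ (s : seq nat) : sumn (map succn s) = (sumn s + size s)%N.
Proof. by elim: s => //= x s ->; lia. Qed.

Lemma sorted_map_succ (s : seq nat) : sorted leq (map succn s) = sorted leq s.
Proof. by rewrite sorted_map; apply: eq_sorted. Qed.

Lemma mem_map_succ_monoseqs b r s :
  (s \in [seq map succn u | u <- monoseqs b r])
  = [&& sorted leq s, size s == b, sumn s == (r + b)%N & all (leq 1) s].
Proof.
apply/mapP/and4P => [[u]|[s_sorted /eqP s_size /eqP s_sum s_pos]].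
  rewrite mem_monoseqs => /and3P[u_sorted /eqP <- /eqP <-] ->.
  by rewrite sorted_map_succ size_map sumn_map_succ !eqxx all_map all_predT.
have eq_s : s = map succn (map predn s).
  rewrite -map_comp -[LHS]map_id; apply/eq_in_map => x /(allP s_pos) /=.
  by move/prednK.
exists (map predn s) => //; rewrite mem_monoseqs size_map s_size eqxx.
rewrite -sorted_map_succ -eq_s s_sorted /=.
have := sumn_map_succ (map predn s).
by rewrite -eq_s size_map s_sum s_size => /addIn ->.
Qed.

Lemma path_leq0 (s : seq nat) : path leq 0 s = sorted leq s.
Proof. by rewrite (path_sortedE leq_trans) all_predT. Qed.

(** Partitions into exactly [b] positive parts, obtained by adding 1 to each part. The guard
    matters: for [r < b] the truncated [r - b] would yield the sequence of ones, whose sum is not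
    [r]. *)
Definition posmonoseqs (b r : nat) : seq (seq nat) :=
  if (b <= r)%N then [seq map succn u | u <- monoseqs b (r - b)] else [::].

Lemma mem_posmonoseqs b r s : (s \in posmonoseqs b r)
  = [&& sorted leq s, size s == b, sumn s == r & all (leq 1) s].
Proof.
rewrite /posmonoseqs; case: leqP => [le_b|lt_r].
  by rewrite mem_map_succ_monoseqs subnK.
apply/esym/negbTE/negP => /and4P[_ /eqP s_size /eqP s_sum s_pos].
have : (size s <= sumn s)%N.
  elim: s s_pos {s_size s_sum} => //= x s IH /andP[x0 /IH]; lia.
lia.
Qed.

Lemma posmonoseqs_uniq b r : uniq (posmonoseqs b r).
Proof.
rewrite /posmonoseqs; case: ifP => // _; rewrite map_inj_uniq ?monoseqs_uniq //.
by apply: inj_map; apply: succn_inj.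
Qed.

(** Either the smallest part is 0 and can be removed, or all parts are positive and can be lowered
    by 1. *)
Lemma size_monoseqs_recl b r : size (monoseqs b.+1 r) = (size (monoseqs b r)
  + (if b < r then size (monoseqs b.+1 (r - b.+1)) else 0))%N.
Proof.
set l2 := posmonoseqs b.+1 r.
have l_perm : perm_eq (monoseqs b.+1 r) (map (cons 0%N) (monoseqs b r) ++ l2).
  apply: uniq_perm; first exact: monoseqs_uniq.
    rewrite cat_uniq map_inj_uniq ?monoseqs_uniq => [|x y []] //=.
    rewrite posmonoseqs_uniq andbT; apply/hasPn => s; rewrite mem_posmonoseqs.
    by move=> /and4P[_ _ _ s_pos]; apply/mapP => -[u _ e]; rewrite e in s_pos.
  move=> s; rewrite mem_cat mem_posmonoseqs mem_monoseqs.
  case: s => [|[|x] s] /=.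
  - by apply/esym/orP => -[/mapP[]|].
  - rewrite !andbF orbF (mem_map (f := cons 0%N)) => [|? ? []] //.
    by rewrite mem_monoseqs path_leq0 add0n.
  rewrite [X in _ = X || _](_ : _ = false); last by apply/mapP => -[].
  rewrite /= andbC [RHS]andbC -!andbA; congr (_ && _).
  rewrite (path_sortedE leq_trans); case: allP => [H|_]; last by rewrite !andbF.
  by have -> : all (leq 1) s by apply/allP => y /H; apply: leq_trans.
rewrite (perm_size l_perm) size_cat size_map /l2 /posmonoseqs; case: ifP => //.
by rewrite size_map.
Qed.

(** The product counts partitions with parts of size at most [b], the list those with at most [b]
    parts; the common recurrence takes the place of conjugation. *)
Lemma size_monoseqs b r : (size (monoseqs b r))%:R = P_upto b r.
Proof.
elim: b r => [|b IHb] r.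
  rewrite /P_upto big_nil /fps_poly coef1.
  have : perm_eq (monoseqs 0 r) (if r == 0%N then [:: [::]] else [::]).
    apply: uniq_perm; [exact: monoseqs_uniq | by case: ifP | case].
      by rewrite mem_monoseqs /= eq_sym; case: ifP.
    by move=> x s; rewrite mem_monoseqs /= andbF; case: ifP.
  by move=> /perm_size ->; case: ifP.
elim/ltn_ind: r => r IHr; rewrite size_monoseqs_recl P_upto_recl natrD IHb.
congr (_ + _); case: ifP => // lt_b; apply: IHr; lia.
Qed.

(** * Tableaux with a long first row *)

Section Rows.
Variables (la : seq nat) (N : nat).
Implicit Types (t : {ffun cell la -> 'I_N}).

(** The sum has at most one term. It reads the entry at a position without a proof that the position
    lies in the diagram, and gives 0 outside. *)
Definition entry t (i j : nat) : nat :=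
  \sum_(c | (cell_row c == i) && (cell_col c == j)) t c.

Lemma entryE t c : entry t (cell_row c) (cell_col c) = t c.
Proof.
rewrite /entry (big_pred1 c) // => d /=; apply/andP/eqP => [[/eqP er /eqP ec]|->//].
exact: cell_inj.
Qed.

Definition row_seq t (i : nat) : seq nat := mkseq (entry t i) (nth 0%N la i).

Lemma nth_row_seq t c : nth 0%N (row_seq t (cell_row c)) (cell_col c) = t c.
Proof. by rewrite nth_mkseq ?entryE ?cell_colP. Qed.

Lemma sumn_row_seq t i : sumn (row_seq t i) = (\sum_(c | cell_row c == i) t c)%N.
Proof.
rewrite sumnE big_map -{1}[nth 0%N la i]subn0 -/(index_iota 0 _) big_mkord.
rewrite (exchange_big_dep (fun c => cell_row c == i)) /=; last by move=> j c _ /andP[].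
apply: eq_bigr => c /eqP <-; rewrite (big_pred1 (Ordinal (cell_colP c))) // => j /=.
by rewrite eqxx eq_sym.
Qed.

Lemma row_seq_sorted t i : is_ssyt t -> sorted leq (row_seq t i).
Proof.
case/ssytP=> Hr _; apply/(sortedP 0%N) => j; rewrite size_mkseq => lt_j.
rewrite !nth_mkseq //; last exact: ltnW.
have [c cr cc] := cell_ex (ltnW lt_j); have [d dr dc] := cell_ex lt_j.
rewrite -{1}cr -{1}cc -dr -dc !entryE; apply: Hr; first by rewrite cr.
by rewrite cc dc.
Qed.

End Rows.

(* When the first row is much longer than r, the entries of a tableau of sum r
   below which the second row sits all vanish, so that the two rows only
   interact through the condition that the second has positive entries. *)
Lemma card_ssyt_two_row p b m r : (0 < p)%N -> (r + b <= p)%N -> (r <= m)%N ->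
  #|[set t : {ffun cell (two_row p b) -> 'I_m.+1} | is_ssyt t
      & (\sum_c t c)%N == r]|%:R
  = fps_mul P_series (fps_mul (P_upto b) (fps_poly 'X^b)) r.
Proof.
set nu := two_row p b => p0 le_rbp le_rm; set A := [set t | _].
have nu0 : nth 0%N nu 0 = p by rewrite /nu /two_row /= p0.
have nu1 : nth 0%N nu 1 = b by rewrite /nu /two_row /= p0; case: b {nu A nu0 le_rbp}.
have nu_size : (size nu <= 2)%N by rewrite /nu /two_row /= p0; case: ifP.
have nu_part : is_part nu by apply: is_part_two_row; lia.
have row1 (c : cell nu) : cell_row c != 0%N -> cell_row c = 1%N.
  by have := cell_rowP c; lia.
pose phi (t : {ffun cell nu -> 'I_m.+1}) := (row_seq t 0, row_seq t 1).
pose L := [seq uv | i <- iota 0 r.+1,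
  uv <- [seq (u, v) | u <- monoseqs p i, v <- posmonoseqs b (r - i)]].
have mem_L u v : ((u, v) \in L) = [&& sorted leq u, size u == p,
    sorted leq v, size v == b, all (leq 1) v & (sumn u + sumn v == r)%N].
  apply/allpairsPdep/and5P => [[i [uv []]]|].
    rewrite mem_iota => le_i /allpairsP[[u' v'] /= []].
    rewrite mem_monoseqs mem_posmonoseqs => /and3P[us up /eqP ui].
    move=> /and4P[vs vb /eqP vi v_pos] -> [-> ->]; split=> //.
    by rewrite v_pos ui vi subnKC //; lia.
  move=> [us up vs vb /andP[v_pos /eqP uv_sum]]; exists (sumn u), (u, v).
  rewrite mem_iota; split=> //; first by lia.
  apply/allpairsP; exists (u, v); rewrite /= mem_monoseqs mem_posmonoseqs.
  by rewrite us up vs vb v_pos -uv_sum addKn !eqxx.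
have L_uniq : uniq L.
  apply: allpairs_uniq_dep; first exact: iota_uniq.
    move=> i _; apply: allpairs_uniq; rewrite ?monoseqs_uniq ?posmonoseqs_uniq //.
    by move=> [? ?] [? ?].
  (* The index of the sublist containing a pair is recovered as the sum of its first row. *)
  have sum_fst (i : nat) uv :
      uv \in [seq (u, v) | u <- monoseqs p i, v <- posmonoseqs b (r - i)] ->
      sumn uv.1 = i.
    by move=> /allpairsP[[u v] /= []]; rewrite mem_monoseqs => /and3P[_ _ /eqP <-] _ ->.
  move=> x y /allpairsPdep[i [uv [_ /sum_fst uv_i ->]]].
  move=> /allpairsPdep[j [uv' [_ /sum_fst uv_j ->]]] /= e.
  by move: uv_i uv_j; rewrite e => -> ->.
have phi_inj : injective phi.
  move=> t u [e0 e1]; apply/ffunP => c; apply/val_inj.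
  rewrite /= -!nth_row_seq; have [->|/row1->] := eqVneq (cell_row c) 0%N.
    by rewrite e0.
  by rewrite e1.
have sum_rows (t : {ffun cell nu -> 'I_m.+1}) :
    (\sum_c t c = sumn (row_seq t 0) + sumn (row_seq t 1))%N.
  rewrite !sumn_row_seq (bigID (fun c => cell_row c == 0%N)) /=; congr addn.
  by apply: eq_bigl => c; apply/idP/eqP => [/row1|->].
have phi_A : perm_eq [seq phi t | t in A] L.
  apply: uniq_perm => //; first by rewrite map_inj_uniq ?enum_uniq.
  move=> [u v]; rewrite mem_L; apply/imageP/idP => [[t]|].
    rewrite inE => /andP[t_ssyt /eqP t_sum] [-> ->].
    rewrite !row_seq_sorted // !size_mkseq nu0 nu1 !eqxx -sum_rows t_sum eqxx andbT /=.
    apply/(all_nthP 0%N) => j; rewrite size_mkseq => lt_j.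
    have [c cr cc] := cell_ex lt_j; rewrite -cr -cc nth_row_seq.
    by have := ssyt_row_le c nu_part t_ssyt; rewrite cr.
  move=> /and5P[us /eqP up vs /eqP vb /andP[v_pos /eqP uv_sum]].
  pose w (i : nat) := if i == 0%N then u else v.
  pose t : {ffun cell nu -> 'I_m.+1} :=
    [ffun c => inord (nth 0%N (w (cell_row c)) (cell_col c))].
  have w_size i : (i < 2)%N -> size (w i) = nth 0%N nu i.
    by case: i => [|[|i]] //; rewrite /w /= ?nu0 ?nu1.
  have w_sorted i : sorted leq (w i) by rewrite /w; case: ifP.
  have w_sum i : (sumn (w i) <= r)%N by rewrite /w; case: ifP; lia.
  have row_lt2 (c : cell nu) : (cell_row c < 2)%N := leq_trans (cell_rowP c) nu_size.
  (* [inord] loses nothing: a part is at most the sum of its row, hence at most [r] and so at most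
     [m]. *)
  have tE c : t c = nth 0%N (w (cell_row c)) (cell_col c) :> nat.
    rewrite ffunE inordK // ltnS (leq_trans _ le_rm) //.
    rewrite (leq_trans _ (w_sum (cell_row c))) //.
    by apply: leq_sumn; rewrite mem_nth // w_size // cell_colP.
  have rowE i : (i < 2)%N -> row_seq t i = w i.
    move=> lt_i; apply: (@eq_from_nth _ 0%N); rewrite size_mkseq ?w_size // => j lt_j.
    by have [c cr cc] := cell_ex lt_j; rewrite -cr -cc nth_row_seq tE.
  exists t; last by rewrite /phi !rowE.
  rewrite inE sum_rows !rowE // /w /= uv_sum eqxx andbT.
  apply/ssytP; split=> c d e lt_cd; rewrite !tE.
    rewrite -e; apply: (sorted_leq_nth leq_trans leqnn) => //; last exact: ltnW.
      by rewrite inE w_size // cell_colP.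
    by rewrite inE w_size // e cell_colP.
  have dr : cell_row d = 1%N by have := row_lt2 d; lia.
  have cr : cell_row c = 0%N by have := row_lt2 d; lia.
  have lt_col : (cell_col d < b)%N by have := cell_colP d; rewrite dr nu1.
  rewrite cr dr e /w /=; apply: (@leq_ltn_trans 0); last first.
    by apply: (allP v_pos); rewrite mem_nth // vb.
  (* If the first row were positive above [d], all its entries from that column on would be
     positive. There are more than [p - b] of them, hence more than [r], and their sum would exceed
     [r]. *)
  rewrite leqn0 -leqn0 leqNgt; apply/negP => u_pos.
  have drop_sum : (sumn (drop (cell_col d) u) <= sumn u)%N.
    by rewrite -{2}(cat_take_drop (cell_col d) u) sumn_cat leq_addl.
  have drop_pos : (size (drop (cell_col d) u) <= sumn (drop (cell_col d) u))%N.
    have : all (leq 1) (drop (cell_col d) u).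
      apply/(all_nthP 0%N) => j; rewrite size_drop nth_drop => lt_j.
      apply: leq_trans u_pos _; apply: (sorted_leq_nth leq_trans leqnn) => //.
      - by rewrite inE; lia.
      - by rewrite inE; lia.
      by rewrite leq_addr.
    by elim: (drop _ _) => //= x s IH /andP[x0 /IH]; lia.
  by move: drop_pos drop_sum; rewrite size_drop; lia.
have -> : #|A| = size L by rewrite -(perm_size phi_A) size_map cardE.
rewrite size_allpairs_dep sumnE big_map.
rewrite -[iota _ _]/(index_iota 0 r.+1) big_mkord natr_sum /fps_mul.
apply: eq_bigr => i _; rewrite size_allpairs natrM size_monoseqs.
(* The first row has sum [i <= r <= p], so the bound [p] on the number of its parts is no
   restriction and the infinite product appears. *)
rewrite P_upto_stable; last first.
  by apply: leq_trans _ (leq_trans (leq_addr b r) le_rbp); rewrite -ltnS.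
congr (_ * _); rewrite -[RHS]/(fps_mul _ _ _) fps_mulXn /posmonoseqs.
by case: ifP => // _; rewrite size_map size_monoseqs.
Qed.

(** * Plethysm with a one-row Schur function in two variables *)

Lemma pad2_inj i j i' j' :
  pad 2 [:: i; j] = pad 2 [:: i'; j'] -> i = i' /\ j = j'.
Proof.
move=> /mnmP e; have := e 0; have := e 1; rewrite !mnmE /=.
by move=> -> ->.
Qed.

Lemma pad2E (w : 'X_{1..2}) : w = pad 2 [:: w 0; w 1].
Proof.
apply/mnmP => k; rewrite mnmE; by have [->|->] := ord2_cases k.
Qed.

Lemma perm_monomials_row m : (0 < m)%N ->
  perm_eq (monomials (schur (two_row m 0) 2))
          [seq pad 2 [:: (m - i)%N; i] | i <- iota 0 m.+1].
Proof.
move=> m0; apply/allP => w _; apply/eqP.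
rewrite count_monomials count_uniq_mem; last first.
  rewrite map_inj_in_uniq ?iota_uniq // => i j _ _ /pad2_inj[] //.
have part_m := is_part_two_row (leq0n m).
have [w_sum|w_sum] := eqVneq m (w 0%R + w 1%R)%N.
  have -> : (schur (two_row m 0) 2)@_w = 1.
    rewrite [w]pad2E mcoeff_schur2 // ?sumn_two_row ?addn0 //.
    by rewrite /two_row /= m0 /= w_sum leq_addr.
  suff -> : w \in [seq pad 2 [:: (m - i)%N; i] | i <- iota 0 m.+1] by [].
  apply/mapP; exists (w 1%R).
    by rewrite mem_iota /=; lia.
  by rewrite w_sum addnK -pad2E.
have -> : (schur (two_row m 0) 2)@_w = 0.
  have [_ _ schur_homog] := schur_symfun part_m.
  apply: contraNeq w_sum => /schur_homog.
  rewrite mdegE !big_ord_recl big_ord0 addn0 sumn_two_row addn0 => <-.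
  by apply/eqP; congr (w _ + w _)%N; apply: val_inj.
rewrite absz0.
suff /negbTE-> : w \notin [seq pad 2 [:: (m - i)%N; i] | i <- iota 0 m.+1] by [].
apply: contra w_sum.
by move=> /mapP[i]; rewrite mem_iota => le_i ->; rewrite !mnmE /=; lia.
Qed.

(** Entry [i] stands for x^(m-i) y^i, so the exponent of y is the sum of the entries; the exponent
    of x is its complement in [sumn nu * m]. *)
Lemma mcoeff_plethysm_row nu m s :
  is_part nu -> (0 < m)%N -> (s <= sumn nu * m)%N ->
  (plethysm (schur nu) (schur (two_row m 0)) 2)@_(pad 2 [:: (sumn nu * m - s)%N; s])
  = #|[set t : {ffun cell nu -> 'I_m.+1} | is_ssyt t & (\sum_c t c)%N == s]|%:R.
Proof.
move=> nu_part m0 le_s; rewrite plethysmE.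
(* Symmetry of the outer Schur polynomial allows the monomials to be listed by increasing exponent
   of y, so that the index of a variable is that exponent. *)
rewrite (perm_evs nu_part (perm_map _ (perm_monomials_row m0))) -map_comp.
rewrite (@evsE _ _ m.+1); last by rewrite size_map size_iota.
rewrite (eq_ev _ (z := fun i : 'I_m.+1 => 'X_[pad 2 [:: (m - i)%N; i : nat]])).
  rewrite mcoeff_ev; congr (_%:R); apply: eq_card => t; rewrite !inE.
  congr (_ && _).
  have sumE : (\sum_c pad 2 [:: (m - t c)%N; t c : nat])%MM
      = pad 2 [:: (sumn nu * m - \sum_c t c)%N; (\sum_c t c)%N].
    apply/mnmP => k; rewrite mnm_sumE mnmE.
    under eq_bigr do rewrite mnmE.
    have [->|->] := ord2_cases k; last by [].
    rewrite /= -card_cell -sum_nat_const -sumnB // => c _.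
    by rewrite -ltnS.
  by rewrite sumE; apply/eqP/eqP => [/pad2_inj[]|->].
move=> i; rewrite (nth_map 0%N) ?size_iota // nth_iota //.
Qed.

Theorem proposition10p7 (b : nat) :
  (exists L : fps,
     (forall r : nat,
        stable_limit
          (fun m n => plethysm_coef (two_row (n - b)%N b) (two_row m 0)
                                    (two_row (m * n - r)%N r))
          (L r))
     /\ L =1 fps_mul
               (fps_div (fps_poly ('X^b * (1 - 'X)))
                        (fps_poly (\prod_(1 <= i < b.+1) (1 - 'X^i))))
               P_series)
  /\ ((1 <= b)%N ->
      fps_mul
        (fps_div (fps_poly ('X^b * (1 - 'X)))
                 (fps_poly (\prod_(1 <= i < b.+1) (1 - 'X^i))))
        P_series
      =1 fps_mul
           (fps_div (fps_poly 'X^b)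
                    (fps_poly (\prod_(2 <= i < b.+1) (1 - 'X^i))))
           P_series).
Proof.
split; last first.
  move=> b0; rewrite big_ltn //.
  have -> : (1 - 'X : {poly int}) = 1 - 'X^1 by rewrite expr1.
  rewrite /fps_div fps_polyM fps_invM ?coef0_prod_1subXn ?coef0_1subXn //.
  set u := fps_poly (1 - _); have u_inv : fps_mul u (fps_inv u) = fps_poly 1.
    rewrite fps_mulC; apply: functional_extensionality; apply: fps_mulVr.
    by rewrite /u /fps_poly coef0_1subXn ?unitr1.
  by rewrite -(fps_mulA _ u) (fps_mulA u) u_inv fps_mul1.
(* The right-hand side itself is taken as [L]; what remains is that its coefficients are the
   limits. *)
eexists; split; last by move=> r; reflexivity.
rewrite /fps_div fps_inv_prod => r.
pose A := fps_mul P_series (fps_mul (P_upto b) (fps_poly 'X^b)).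
have -> : fps_mul (fps_mul (fps_poly ('X^b * (1 - 'X))) (P_upto b)) P_series
    = fps_mul A (fps_poly (1 - 'X^1)).
  rewrite expr1 fps_polyM /A fps_mulC -[RHS]fps_mulA; congr fps_mul.
  by rewrite fps_mulC fps_mulA.
(* Beyond this bound [n - b] is positive and at least [r + b], as the count with a long first row
   requires; moreover [m] is positive and at least [r], and [r + r <= n * m]. *)
exists (2 * (b + r)).+1 => m n le_m le_n.
have le_bn : (b <= n)%N by lia.
have le_b : (b <= n - b)%N by lia.
have le_rnm : (r + r <= n * m)%N by nia.
have nu_part := is_part_two_row le_b; have mu_part := is_part_two_row (leq0n m).
have nu_sum : sumn (two_row (n - b) b) = n by rewrite sumn_two_row subnK.
have mu_sum : sumn (two_row m 0) = m by rewrite sumn_two_row addn0.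
rewrite /plethysm_coef nu_sum mu_sum [(m * n)%N]mulnC.
have F_sym := plethysm_symfun nu_part (schur_symfun mu_part).
rewrite nu_sum mu_sum in F_sym; rewrite schur_coef_two_row //.
have coefE s : (s <= r)%N ->
    (plethysm (schur (two_row (n - b) b)) (schur (two_row m 0)) 2)@_
      (pad 2 [:: (n * m - s)%N; s]) = A s.
  move=> le_s; have := @mcoeff_plethysm_row _ m s nu_part.
  rewrite nu_sum => ->; [|lia|lia].
  by rewrite card_ssyt_two_row //; lia.
rewrite coefE // fps_mul_1subXn; congr (_ - _).
by case: r {le_m le_n le_rnm} coefE => [|s] coefE //; rewrite coefE // subn1.
Qed.
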